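(* Let $C: f=0$ be a nodal curve of degree $N$ in $\mathbb{P}^2$. Then $ct(C)\geq 2N-4$.
   Context: We work over $\mathbb{C}$. Let $S=\mathbb{C}[x,y,z]$ with its standard grading, $S_r$ the space of homogeneous polynomials of degree $r$. For $f\in S_N$ let $J_f\subset S$ be the ideal generated by the partial derivatives $f_x,f_y,f_z$, and let $M(f)=S/J_f$ be the graded Milnor algebra, with degree $k$ component $M(f)_k$. A nodal curve is a reduced plane curve (not necessarily irreducible) all of whose singularities are nodes (ordinary double points $A_1$). Let $f_s\in S_N$ be any polynomial such that $f_s=0$ is a smooth curve in $\mathbb{P}^2$ (the dimensions $\dim M(f_s)_k$ depend only on $N$ and $k$). The coincidence threshold is $$ct(C)=\max\{q : \dim M(f)_k=\dim M(f_s)_k \text{ for all } k\le q\},$$ understood as $+\infty$ if the equality holds for all $k$. *)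

(* Defs.v *)
From HB Require Import structures.
From mathcomp Require Import all_boot all_order all_algebra.
From mathcomp Require Import complex mpoly.
From mathcomp Require Import boolp classical_sets reals constructive_ereal ereal.

Set Implicit Arguments.
Unset Strict Implicit.
Unset Printing Implicit Defensive.

Import Order.TTheory GRing.Theory Num.Theory.
Local Open Scope ring_scope.
Local Open Scope complex_scope.

Lemma ex_vspace (K : fieldType) (V : vectType K) (P : V -> Prop) :
  P 0 -> (forall (a : K) (u v : V), P u -> P v -> P (a *: u + v)) ->
  exists U : {vspace V}, forall v, v \in U <-> P v.
Proof.
move=> P0 Plin.
pose sub (U : {vspace V}) := forall v, v \in U -> P v.
pose d n := `[< exists U : {vspace V}, sub U /\ \dim U = n >].
have dP : exists n, d n.
  exists 0; apply/asboolP; exists 0%VS; split; last exact: dimv0.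
  by move=> v; rewrite memv0 => /eqP ->.
have dmax n : d n -> (n <= \dim {:V})%N.
  by move=> /asboolP[U [_ <-]]; rewrite dimvS ?subvf.
have [n /asboolP[U [subU dimU]] maxn] := ex_maxnP dP dmax.
exists U => v; split; first exact: subU.
move=> Pv; have : d (\dim (<[v]> + U)%VS).
  apply/asboolP; exists (<[v]> + U)%VS; split => // w.
  by move=> /memv_addP[_ /vlineP[a ->] [u /subU Pu ->]]; apply: Plin.
move=> /maxn; rewrite -dimU => le.
have /eqP -> : U == (<[v]> + U)%VS by rewrite eqEdim addvSr.
by rewrite (subvP (addvSl _ _)) ?memv_line.
Qed.

Section PlaneCurves.
Variable R : realType.
Local Notation C := (R[i]).
Implicit Types (f g h p : {mpoly C[3]}) (v : 'I_3 -> C).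

Definition jacobian_ideal f p : Prop :=
  exists a : 'I_3 -> {mpoly C[3]}, p = \sum_i a i * f^`M(i).

Lemma ex_jacobian_part f (k : nat) :
  exists U : {vspace dhomog 3 C k},
    forall p : dhomog 3 C k, p \in U <-> jacobian_ideal f (val p).
Proof.
apply: (@ex_vspace _ _ (fun p : dhomog 3 C k => jacobian_ideal f (val p))).
  by exists (fun=> 0); rewrite big1 // => i _; rewrite mul0r.
move=> c p q [a pE] [b qE]; exists (fun i => c *: a i + b i).
rewrite linearP /= pE qE scaler_sumr -big_split /=.
by apply: eq_bigr => i _; rewrite mulrDl scalerAl.
Qed.

Definition jacobian_part f (k : nat) : {vspace dhomog 3 C k} :=
  sval (cid (ex_jacobian_part f k)).

Lemma jacobian_partP f (k : nat) (p : dhomog 3 C k) :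
  p \in jacobian_part f k <-> jacobian_ideal f (val p).
Proof. exact: (svalP (cid (ex_jacobian_part f k)) p). Qed.

(* dim M(f)_k, where M(f)_k is the quotient of S_k by J_f :&: S_k. *)
Definition milnor_dim f (k : nat) : nat :=
  (\dim {: dhomog 3 C k} - \dim (jacobian_part f k))%N.

(* Points of P^2 are given by homogeneous coordinates v, not all zero. *)
Definition proj_point v : Prop := exists i, v i != 0.

Definition singular_point f v : Prop :=
  [/\ proj_point v, f.@[v] = 0 & forall i, (f^`M(i)).@[v] = 0].

(* Equation of f = 0 in the affine chart x_i <> 0, in the coordinates centred
   at v: x_i := 1, and x_j := v_j / v_i + y for each of the other two j. *)
Definition local_equation f v (i : 'I_3) : {mpoly C[2]} :=
  f \mPo [tuple if unlift i j is Some l then (v j / v i)%:MP + 'X_l else 1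
         | j < 3].

(* The origin is a double point of g = 0 with two distinct tangent lines. *)
Definition ordinary_double_point (g : {mpoly C[2]}) : Prop :=
  [/\ pihomog mdeg 0 g = 0, pihomog mdeg 1 g = 0 &
      exists l1 l2 : dhomog 2 C 1,
        free [:: l1; l2] /\ pihomog mdeg 2 g = val l1 * val l2].

Definition node f v : Prop :=
  exists2 i, v i != 0 & ordinary_double_point (local_equation f v i).

Definition plane_curve (N : nat) f : Prop :=
  [/\ (0 < N)%N, f \is N.-homog & f != 0].

Definition reduced f : Prop :=
  forall g h, f = g ^+ 2 * h -> exists c : C, g = c%:MP.

Definition nodal_curve (N : nat) f : Prop :=
  [/\ plane_curve N f, reduced f & forall v, singular_point f v -> node f v].

Definition smooth_curve (N : nat) f : Prop :=
  plane_curve N f /\ forall v, ~ singular_point f v.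

(* The set of admissible q contains all negative integers and is closed
   downwards, so its supremum is a maximum whenever it is finite. *)
Definition ct f fs : \bar R :=
  ereal_sup [set (q%:~R : R)%:E | q in
    [set q : int | forall k : nat, k%:Z <= q ->
                     milnor_dim f k = milnor_dim fs k]]%classic.

End PlaneCurves.

(* Main.v *)
Require Import Defs.
From HB Require Import structures.
From mathcomp Require Import all_boot all_order all_algebra.
From mathcomp Require Import complex mpoly.
From mathcomp Require Import boolp classical_sets reals constructive_ereal ereal.
From mathcomp Require Import topology normedtype separable ring.

Set Implicit Arguments.
Unset Strict Implicit.
Unset Printing Implicit Defensive.

Import Order.TTheory GRing.Theory Num.Theory.
Import numFieldNormedType.Exports.
Local Open Scope ring_scope.
Local Open Scope complex_scope.

(** Write J for the Jacobian ideal of a form f of degree N. For k < N - 1 the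
    degree k part of J is zero; for k = d + N - 1 it is the image of
      (a_0, a_1, a_2) |-> a_0 f_0 + a_1 f_1 + a_2 f_2
    on triples of forms of degree d, where f_i is the i-th partial derivative.
    So if f has no nonzero syzygy of degree d <= N - 3 among its partial
    derivatives, then for k <= 2N - 4 the dimension of J in degree k depends
    on N and k only. It remains to show that there is no such syzygy when all
    singularities of f = 0 are nodes, in particular when there are none
    ([no_syzygy_le]). Multiplying by a power of a coordinate, one may take
    d = N - 3.

    A syzygy a is a homogeneous vector field tangent to the level sets of f.
    Its cross product with the position vector, w = X x a, has degree N - 2
    and describes the induced foliation of the plane, which leaves f = 0
    invariant; the statement is then the bound of Cerveau and Lins Neto on the
    degree of such a foliation. On the cone f = 0 both X and a are orthogonal
    to grad f, so w = h grad f there, with h homogeneous of degree -1: a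
    section of a negative line bundle on the curve, possibly with poles at the
    singular points. Two facts show that h = 0.

    - h is bounded ([global_bound]). At a node v, differentiating the relation
      gives Hess f (v) a(v) = 0, so a(v) is proportional to v and w(v) = 0,
      whereas grad f grows at least linearly with the distance to the node.
      Hence |w| <= K |grad f| near every point of the projective plane, and
      compactness makes K uniform.

    - A bounded h vanishes ([vanish_off_discriminant]). Project the curve from
      a point q off it, with x an affine coordinate on the pencil of lines
      through q. Let f' and W be the components of grad f and w along q. For a
      constant t, the product Q_t(x) of the values t f' - W at the N points of
      the curve on the line x, and the product D(x) of the values of f', are
      polynomials in x, being norms. The ratio Q_t / D is the product of the
      t - h, which is bounded and tends to t^N at infinity. So Q_t = t^N D,
      by a Liouville theorem ([bounded_ratio_const]) that only uses that
      complex polynomials have roots. Taking for t a value of h gives h = 0.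

    The polynomial D is not zero, that is, a general line through q meets the
    curve in N distinct points: otherwise f would have a double factor over
    the field of rational functions in x, and the Hessian would be degenerate
    at a singular point ([no_double_factor]). So w vanishes at N distinct
    points of a general line through q; its degree is N - 2, hence w = 0. Then
    X_i a_j = X_j a_i, and Euler's relation N f = sum_i X_i f_i yields
      N f a_j = X_j (sum_i a_i f_i) = 0,
    so a = 0. *)

(** * Polynomial functions and derivations *)

Lemma ex_nonroot (K : numFieldType) (p : {poly K}) : p != 0 -> exists x, p.[x] != 0.
Proof.
move=> p0; pose s : seq K := [seq k%:R | k <- iota 0 (size p)].
have /allPn[x _ px] : ~~ all (root p) s.
  apply: contra p0 => ps; apply/eqP; apply: (roots_geq_poly_eq0 ps).
    by rewrite map_inj_uniq ?iota_uniq // => a b /eqP; rewrite eqr_nat => /eqP.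
  by rewrite size_map size_iota.
by exists x.
Qed.

Lemma horner_eq0 (K : numFieldType) (p : {poly K}) : (forall x, p.[x] = 0) -> p = 0.
Proof.
move=> p0; apply/eqP; apply: contraT => /ex_nonroot[x].
by rewrite p0 eqxx.
Qed.

Section MPolyCalculus.
Variables (n : nat) (R : comNzRingType).
Implicit Types p q : {mpoly R[n]}.

(** Multiplication by variables instead of arbitrary monomials: identities and
    estimates for polynomials then reduce to a product rule with one factor a
    coordinate. *)
Lemma mpoly_indXD (P : {mpoly R[n]} -> Prop) :
    (forall c, P c%:MP) -> (forall p q, P p -> P q -> P (p + q)) ->
    (forall i p, P p -> P ('X_i * p)) ->
  forall p, P p.
Proof.
move=> PC PD PX; have PXm m p : P p -> P ('X_[m] * p).
  rewrite (mpolyXE_id R m); pose K x := forall p, P p -> P (x * p).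
  move: p; apply: (big_ind K); first by move=> p; rewrite mul1r.
    by move=> x y Kx Ky p Pp; rewrite -mulrA; apply/Kx/Ky.
  move=> i _; elim: (m i) => [|k IHk] p Pp; first by rewrite mul1r.
  by rewrite exprS -mulrA; apply/PX/IHk.
elim/mpolyind=> [|c m p _ _ Pp]; first by rewrite -(mpolyC0 n); apply: PC.
by apply: PD => //; rewrite -mul_mpolyC mulrC; apply: PXm.
Qed.

Lemma mderiv_XU (i j : 'I_n) : ('X_i : {mpoly R[n]})^`M(j) = (i == j)%:R.
Proof.
rewrite mderivX mnm1E; case: eqVneq => [->|_]; last by rewrite scale0r.
by rewrite (_ : (U_(j) - U_(j))%MM = 0%MM) ?mpolyX0 ?scale1r //;
  apply/mnmP => k; rewrite mnmBE subnn mnm0E.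
Qed.

(** Both sides are derivations along phi that agree on the variables. This
    single form of the chain rule serves restriction to lines, restriction to
    a pencil of lines through a point, and affine charts. *)
Lemma derivation_chain_rule (B : comNzRingType) (d : {additive B -> B})
    (phi : {rmorphism {mpoly R[n]} -> B}) :
    (forall x y, d (x * y) = d x * y + x * d y) ->
    (forall c, d (phi c%:MP) = 0) ->
  forall p, d (phi p) = \sum_i d (phi 'X_i) * phi p^`M(i).
Proof.
move=> dM dC; apply: mpoly_indXD => [c | p q IHp IHq | i p IHp].
- by rewrite dC big1 // => i _; rewrite mderivC rmorph0 mulr0.
- rewrite rmorphD raddfD IHp IHq -big_split; apply: eq_bigr => i _ /=.
  by rewrite mderivD rmorphD mulrDr.
rewrite rmorphM dM IHp mulr_sumr (bigD1 i) //= [RHS](bigD1 i) //=.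
rewrite mderivM mderiv_XU eqxx mul1r rmorphD rmorphM mulrDr -addrA.
congr (_ + _); rewrite mulrCA; congr (_ + _).
apply: eq_bigr => j /negPf ij.
by rewrite mderivM mderiv_XU eq_sym ij mul0r add0r rmorphM mulrCA.
Qed.

Lemma dhomog_mderiv d p i : p \is d.+1.-homog -> p^`M(i) \is d.-homog.
Proof.
move=> /dhomogP hp; apply/dhomogP => m; rewrite mcoeff_msupp mcoeff_mderiv.
move=> pm; have /hp : (m + U_(i))%MM \in msupp p.
  by rewrite mcoeff_msupp; apply: contraNneq pm => ->; rewrite mul0rn.
by rewrite /= mdegD mdeg1 addn1 => -[].
Qed.

Lemma dhomog0_const p : p \is 0.-homog -> p = (p@_0)%:MP.
Proof.
move=> hp; apply/mpolyP => m; rewrite mcoeffC; have [->|m0] := eqVneq m 0%MM.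
  by rewrite mulr1.
by rewrite mulr0 (dhomog_nemf_coeff hp) //= mdeg_eq0.
Qed.

Lemma euler_dhomog d p : p \is d.-homog ->
  \sum_i 'X_i * p^`M(i) = p *+ d.
Proof.
move=> /dhomogP hp; rewrite {2}[p]mpolyE -sumrMnl.
under eq_bigr => i _ do rewrite {1}[p]mpolyE raddf_sum mulr_sumr.
rewrite exchange_big /= big_seq [RHS]big_seq; apply: eq_bigr => m /hp <-.
rewrite /= mdegE -sumrMnr; apply: eq_bigr => i _.
rewrite mderivZ mderivX -!scalerAr; case E: (m i) => [|k].
  by rewrite scale0r scaler0.
rewrite -mpolyXD addmC submK; last by rewrite lep1mP E.
by rewrite scaler_nat scalerMnr.
Qed.

Lemma meval_at0 p : p.@[fun=> 0] = p@_0.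
Proof.
elim/mpoly_indXD: p => [c | p q IHp IHq | i p IHp].
- by rewrite mevalC mcoeffC eqxx mulr1.
- by rewrite mevalD mcoeffD IHp IHq.
by rewrite mevalM mevalXU mul0r rmorphM /= mcoeffX mnm1_eq0 mul0r.
Qed.

Lemma meval_dhomogZ d p c (v : 'I_n -> R) : p \is d.-homog ->
  p.@[fun i => c * v i] = c ^+ d * p.@[v].
Proof.
move=> /dhomogP hp; rewrite !mevalE mulr_sumr big_seq [RHS]big_seq.
apply: eq_bigr => m /hp <-; rewrite mulrCA; congr (_ * _).
rewrite /= mdegE -prodrXr -big_split /=.
by apply: eq_bigr => i _; rewrite exprMn.
Qed.

Lemma euler_meval d p v : p \is d.-homog ->
  \sum_i v i * (p^`M(i)).@[v] = d%:R * p.@[v].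
Proof.
move=> hp; rewrite mulr_natl -mevalMn -(euler_dhomog hp) raddf_sum /=.
by apply: eq_bigr => i _; rewrite mevalM mevalXU.
Qed.

End MPolyCalculus.

Section Pencil.
Variables (n : nat) (R A : comNzRingType) (k : {rmorphism R -> A}).
Variables (g h : 'I_n -> A).
Implicit Types p q : {mpoly R[n]}.

Definition pencil p : {poly A} :=
  mmap (polyC \o k) (fun i => (g i)%:P + h i *: 'X) p.

HB.instance Definition _ := GRing.RMorphism.copy pencil
  (mmap (polyC \o k) (fun i => (g i)%:P + h i *: 'X)).

Lemma pencilC c : pencil c%:MP = (k c)%:P.
Proof. exact: mmapC. Qed.

Lemma pencilX i : pencil 'X_i = (g i)%:P + h i *: 'X.
Proof. by rewrite /pencil mmapX mmap1U. Qed.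

Lemma deriv_pencil p : (pencil p)^`() = \sum_i h i *: pencil p^`M(i).
Proof.
have /= -> := derivation_chain_rule (d := deriv) (phi := pencil) _ _ p.
- apply: eq_bigr => i _.
  by rewrite pencilX derivD derivC derivZ derivX add0r -mul_polyC mulr1 mul_polyC.
- exact: derivM.
- by move=> c; rewrite pencilC derivC.
Qed.

Lemma horner_pencil p a : (pencil p).[a] = mmap k (fun i => g i + h i * a) p.
Proof.
elim/mpoly_indXD: p => [c|p q IHp IHq|i p IHp].
- by rewrite pencilC hornerC mmapC.
- by rewrite rmorphD hornerD IHp IHq mmapD.
rewrite rmorphM hornerM IHp /= pencilX rmorphM /= mmapX mmap1U.
by rewrite hornerD hornerC hornerZ hornerX.
Qed.

Lemma size_coef_mul (p q : {poly A}) d e :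
    (size p <= d.+1)%N -> (size q <= e.+1)%N ->
  (size (p * q)%R <= (d + e).+1)%N /\ (p * q)`_(d + e) = p`_d * q`_e.
Proof.
move=> sp sq; split.
  apply: leq_trans (size_polyMleq _ _) _.
  by rewrite -ltnS -addnS; case: (_ + size q)%N (leq_add sp sq) => //= s; rewrite addSn.
rewrite coefM (bigD1 (inord d)) //= inordK ?ltnS ?leq_addr // addKn big1 ?addr0 //.
move=> [i /= lti] nei; case: (ltngtP i d) => [ltid|ltdi|eqid].
- rewrite [q`__]nth_default ?mulr0 //; apply: leq_trans sq _.
  by rewrite -addnBAC ?(ltnW ltid) // -[X in (X < _)%N]add0n ltn_add2r subn_gt0.
- by rewrite nth_default ?mul0r //; apply: leq_trans sp _.
by case/eqP: nei; apply: val_inj; rewrite /= inordK ?ltnS ?leq_addr.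
Qed.

Lemma size_coef_exp (p : {poly A}) e : (size p <= 2)%N ->
  (size (p ^+ e)%R <= e.+1)%N /\ (p ^+ e)`_e = p`_1 ^+ e.
Proof.
move=> sp; elim: e => [|e [sz cf]]; first by rewrite size_poly1 coef1.
by rewrite exprS -add1n; have [-> ->] := size_coef_mul sp sz; rewrite cf exprS.
Qed.

(** The coefficient of top degree along a line is the value of the form at the
    point at infinity of that line. *)
Lemma size_coef_pencil d p : p \is d.-homog ->
  (size (pencil p) <= d.+1)%N /\ (pencil p)`_d = mmap k h p.
Proof.
move=> /dhomogP hp; rewrite {1 2}/pencil /mmap coef_sum.
have mon m : mdeg m = d -> (size (mmap1 (fun i => (g i)%:P + h i *: 'X)%R m) <= d.+1)%N
    /\ (mmap1 (fun i => (g i)%:P + h i *: 'X) m)`_d = mmap1 h m.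
  move=> <-; rewrite /= mdegE /mmap1.
  apply: (big_ind3 (fun (x : {poly A}) e (y : A) => (size x <= e.+1)%N /\ x`_e = y)).
  - by rewrite size_poly1 coef1.
  - move=> x1 x2 x3 y1 y2 y3 [sx <-] [sy <-]; exact: size_coef_mul.
  move=> i _; have [|-> ->] := @size_coef_exp ((g i)%:P + h i *: 'X) (m i).
    rewrite (leq_trans (size_polyD _ _)) // geq_max (leq_trans (size_polyC_leq1 _)) //.
    by rewrite (leq_trans (size_scale_leq _ _)) ?size_polyX.
  by rewrite coefD coefC coefZ coefX mulr1 add0r.
split.
  rewrite (leq_trans (size_sum _ _ _)) //; apply/bigmax_leqP_seq => m /hp /mon [sz _] _ /=.
  by rewrite mul_polyC (leq_trans (size_scale_leq _ _)).
rewrite big_seq [RHS]big_seq; apply: eq_bigr => m /hp /mon [_ cf] /=.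
by rewrite coefCM cf.
Qed.

End Pencil.

Lemma map_pencil n (R A B : comNzRingType) (k : {rmorphism R -> A})
    (s : {rmorphism A -> B}) (g h : 'I_n -> A) (p : {mpoly R[n]}) :
  map_poly s (pencil k g h p) = pencil (s \o k) (s \o g) (s \o h) p.
Proof.
elim/mpoly_indXD: p => [c|p q IHp IHq|i p IHp].
- by rewrite !pencilC map_polyC.
- by rewrite !rmorphD /= IHp IHq.
rewrite !rmorphM /= IHp; congr (_ * _).
by rewrite !pencilX rmorphD /= map_polyC map_polyZ map_polyX.
Qed.

Lemma horner_line n (R : comNzRingType) (g h : 'I_n -> R) (p : {mpoly R[n]}) a :
  (pencil idfun g h p).[a] = p.@[fun i => g i + h i * a].
Proof. exact: horner_pencil. Qed.

(** By induction on the degree: the restriction of p to a line vanishes, and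
    its derivative at a point is a directional derivative of p, so that all
    partial derivatives of p vanish as functions as well. *)
Lemma meval_eq0 n (K : numFieldType) (p : {mpoly K[n]}) :
  (forall v, p.@[v] = 0) -> p = 0.
Proof.
move=> p0; have: forall m, m \in msupp p -> (mdeg m < msize p)%N.
  by move=> m; apply: msize_mdeg_lt.
move: (msize p) p0 => d; elim: d p => [|d IHd] p p0 hp.
  by apply/mpolyP => m; rewrite mcoeff0; apply/eqP; rewrite mcoeff_eq0; apply/negP => /hp.
have dp0 i : p^`M(i) = 0.
  apply: IHd => [v|m]; last first.
    rewrite mcoeff_msupp mcoeff_mderiv => pm.
    have /hp : (m + U_(i))%MM \in msupp p.
      by rewrite mcoeff_msupp; apply: contraNneq pm => ->; rewrite mul0rn.
    by rewrite mdegD mdeg1 addn1.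
  pose e j : K := (j == i)%:R.
  have L0 : pencil idfun v e p = 0 by apply: horner_eq0 => x; rewrite horner_line p0.
  have /(congr1 (fun q => q.[0])) := deriv_pencil idfun v e p.
  rewrite L0 deriv0 horner0 horner_sum (bigD1 i) //= big1 ?addr0.
    rewrite hornerZ horner_line /e eqxx mul1r => ->; apply: meval_eq => j.
    by rewrite mulr0 addr0.
  by move=> j /negPf ji; rewrite /e ji scale0r horner0.
apply/mpolyP => m; rewrite mcoeff0; have [->|m0] := eqVneq m 0%MM.
  by rewrite -meval_at0.
have [i mi] : exists i, m i != 0%N.
  apply/existsP; apply: contraNT m0; rewrite negb_exists => /forallP h.
  by apply/eqP/mnmP => i; rewrite mnm0E; apply/eqP; rewrite -[_ == _]negbK.
have := congr1 (mcoeff (m - U_(i))%MM) (dp0 i).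
rewrite mcoeff_mderiv mcoeff0 submK ?lep1mP // => /eqP.
by rewrite mulrn_eq0 /= => /eqP.
Qed.

(** * A Liouville theorem for branched covers of the line *)

Section ClosedField.
Variable C : numClosedFieldType.

(** Liouville for rational functions. After cancelling common factors, P - c D
    can have a root only if c is a value of P / D; all such values outside
    the roots of D are bounded by K, and the finitely many values at roots of D
    are bounded too. So P - c D has no root, hence is constant, for all large c;
    two such c force P and D to be constant. *)
Lemma bounded_ratio_const (P D : {poly C}) (K : C) : D != 0 -> 0 <= K ->
    (forall x, D.[x] != 0 -> `|P.[x]| <= K * `|D.[x]|) ->
  exists c, P = c *: D.
Proof.
move=> D0 K0 leP; pose G := gcdp P D; pose P' := P %/ G; pose D' := D %/ G.
have defP : P = P' * G by rewrite divpK ?dvdp_gcdl.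
have defD : D = D' * G by rewrite divpK ?dvdp_gcdr.
have cPD : coprimep P' D' by rewrite coprimep_div_gcd // D0 orbT.
have [rs defrs] := closed_field_poly_normal D.
(* c0 exceeds K and the values of P' / D' at the roots of D. *)
pose c0 : C := 1 + K + \sum_(s <- rs) `|P'.[s] / D'.[s]|.
have sum0 : 0 <= \sum_(s <- rs) `|P'.[s] / D'.[s]| by apply: sumr_ge0.
have c00 : 0 <= c0 by rewrite !addr_ge0.
have noroot c : c0 <= c -> size (P' - c *: D') = 1%N.
  move=> lec; apply/eqP; apply: contraT => /closed_rootP[x].
  have c_ge0 : 0 <= c by apply: le_trans lec.
  rewrite /root hornerD hornerN hornerZ subr_eq0 => /eqP Px.
  have D'x : D'.[x] != 0.
    apply: contraL cPD => /eqP D'x; apply/negP => /coprimep_root /(_ (_ : root P' x)).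
    by rewrite /root Px D'x mulr0 eqxx => /(_ isT).
  have defc : c = P'.[x] / D'.[x] by rewrite Px mulfK.
  have [Dx|Dx] := eqVneq D.[x] 0.
    have xrs : x \in rs.
      have : root D x by rewrite /root Dx.
      by rewrite defrs rootZ ?lead_coef_eq0 // root_prod_XsubC.
    suff : c < c by rewrite ltxx.
    apply: lt_le_trans lec; rewrite {1}defc -[P'.[x] / _]ger0_norm -?defc //.
    rewrite {1}defc /c0 (perm_big _ (perm_to_rem xrs)) big_cons.
    rewrite addrCA ltrDl -addrA ltr_pwDl ?ltr01 // addr_ge0 //.
    exact: sumr_ge0.
  have := leP x Dx; rewrite defP defD !hornerM Px -mulrA normrM.
  rewrite -hornerM -defD (ger0_norm c_ge0) ler_pM2r ?normr_gt0 // => lecK.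
  suff : c < c by rewrite ltxx.
  apply: le_lt_trans lecK _; apply: lt_le_trans lec; rewrite /c0 addrAC ltrDr.
  by rewrite ltr_wpDr ?ltr01.
clearbody c0; have /eqP/size_poly1P[a a0 Ea] := noroot c0 (lexx _).
have /eqP/size_poly1P[b b0 Eb] := noroot (c0 + 1) (ler_wpDr ler01 (lexx _)).
have ED : D' = (a - b)%:P.
  by rewrite polyCB -Ea -Eb opprB scalerDl scale1r addrC addrA subrK addrAC subrr add0r.
have EP : P' = (a + c0 * (a - b))%:P.
  by rewrite polyCD -Ea ED -mul_polyC -polyCM subrK.
have ab0 : a - b != 0.
  by apply: contraNneq D0 => ab; rewrite defD ED ab mul0r.
exists ((a + c0 * (a - b)) / (a - b)).
by rewrite defD defP EP ED scalerAl -mul_polyC -polyCM mulrVK // unitfE.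
Qed.

Lemma prodr_const_seq (R : pzSemiRingType) (T : Type) (s : seq T) (c : R) :
  \prod_(i <- s) c = c ^+ size s.
Proof. by elim: s => [|x s IHs]; rewrite ?big_nil // big_cons IHs exprS. Qed.

(** The determinant of q(M) is the norm of q from k[X] / (char_poly M), which
    is multiplicative in q; for q = X - s it is the value of the characteristic
    polynomial at s up to sign. *)
Lemma det_horner_mx n (M : 'M[C]_n.+1) (rs : seq C) (q : {poly C}) :
    char_poly M = \prod_(r <- rs) ('X - r%:P) ->
  \det (horner_mx M q) = \prod_(r <- rs) q.[r].
Proof.
move=> defM; have szrs : size rs = n.+1.
  by apply: succn_inj; rewrite -(size_prod_XsubC rs id) -defM size_char_poly.
have detB s : \det (horner_mx M ('X - s%:P)) = \prod_(r <- rs) (r - s).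
  rewrite rmorphB /= horner_mx_X horner_mx_C -opprB -scaleN1r detZ.
  have -> : \det (s%:M - M) = (char_poly M).[s].
    rewrite /char_poly -horner_evalE -det_map_mx; congr (\det _).
    apply/matrixP => i j; rewrite !mxE /= horner_evalE hornerD hornerN hornerC.
    by rewrite hornerMn hornerX.
  rewrite defM horner_prod -szrs -prodr_const_seq -big_split /=.
  by apply: eq_bigr => r _; rewrite hornerXsubC mulN1r opprB.
have [ss ->] := closed_field_poly_normal q; move: (lead_coef q) => c.
rewrite linearZ /= detZ rmorph_prod /=.
under [RHS]eq_bigr => r _ do rewrite hornerZ horner_prod.
rewrite big_split /= exchange_big /=; congr (_ * _).
  by rewrite prodr_const_seq szrs.
elim: ss => [|s ss IHs]; first by rewrite !big_nil det1.
rewrite !big_cons -IHs det_mulmx detB; congr (_ * _).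
by apply: eq_bigr => r _; rewrite hornerXsubC.
Qed.

End ClosedField.

Section Spectral.
Variable C : numClosedFieldType.
Implicit Types F W V q : {poly {poly C}}.

Definition fiber (x : C) : {poly {poly C}} -> {poly C} := map_poly (horner_eval x).

HB.instance Definition _ x := GRing.RMorphism.copy (fiber x) (map_poly (horner_eval x)).

(** If h and z h are bounded then prod (t - h) differs from t ^ n by O(1 / z).
    The bound does not depend on the points, so it can be used uniformly in a
    parameter of which z is a function. *)
Lemma prod_shift_bound (n : nat) (t K : C) : 0 <= K ->
  exists2 B : C, 0 <= B & forall (rs : seq C) (h : C -> C) (z : C), size rs = n ->
    (forall r, r \in rs -> `|h r| <= K /\ `|z * h r| <= K) ->
    `|z * (\prod_(r <- rs) (t - h r) - t ^+ n)| <= B.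
Proof.
move=> K0; elim: n => [|n [B B0 IHn]].
  by exists 0 => // -[|//] h z _ _; rewrite big_nil subrr mulr0 normr0.
exists ((`|t| + K) * B + K * `|t| ^+ n).
  by rewrite addr_ge0 ?mulr_ge0 ?addr_ge0 ?exprn_ge0.
case=> [//|r rs] h z [szrs] hK; rewrite big_cons exprS.
have [|hr zhr] := hK r; first by rewrite inE eqxx.
have -> : z * ((t - h r) * \prod_(j <- rs) (t - h j) - t * t ^+ n) =
  (t - h r) * (z * (\prod_(j <- rs) (t - h j) - t ^+ n)) - (z * h r) * t ^+ n.
  by ring.
rewrite (le_trans (ler_normB _ _)) // lerD // normrM; last first.
  by rewrite normrX ler_wpM2r ?exprn_ge0.
apply: ler_pM => //; first by rewrite (le_trans (ler_normB _ _)) // lerD2l.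
by apply: IHn => // s srs; apply: hK; rewrite inE srs orbT.
Qed.

Lemma ex_char_poly (R : comNzRingType) n (p : {poly R}) :
  p \is monic -> size p = n.+2 -> exists M : 'M[R]_n.+1, char_poly M = p.
Proof.
move=> mp sp; have := companionmxK mp; move: (companionmx p).
by rewrite sp => M defM; exists M.
Qed.

Lemma fiber_monic F x : F \is monic ->
  fiber x F \is monic /\ size (fiber x F) = size F.
Proof.
move=> mF; have nz : horner_eval x (lead_coef F) != 0.
  by rewrite (monicP mF) rmorph1 oner_eq0.
split; last exact: size_map_poly_id0.
by apply/monicP; rewrite lead_coef_map_id0 ?rmorph0 // (monicP mF) rmorph1.
Qed.

Lemma fiber_roots F x n : F \is monic -> size F = n.+1 ->
  exists2 rs, fiber x F = \prod_(r <- rs) ('X - r%:P) & size rs = n.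
Proof.
move=> mF szF; have [mFx sFx] := fiber_monic x mF.
have [rs] := closed_field_poly_normal (fiber x F).
rewrite (monicP mFx) scale1r => defrs; exists rs => //; apply: succn_inj.
by rewrite -(size_prod_XsubC rs id) -defrs sFx.
Qed.

(** F is a family of polynomials in y with parameter x, and h = W / F' on its
    zero set. Being bounded by K / |x| and by K, h is a bounded function on a
    branched cover of the line that vanishes at infinity. The polynomials D and
    N (t F' - W) are norms to C[x], and their ratio, the product of the t - h
    over the fibre, is constant by [bounded_ratio_const]. *)
Lemma vanish_off_discriminant n F W (K : C) :
    F \is monic -> size F = n.+2 -> separable_poly F -> 0 <= K ->
    (forall x y, (fiber x F).[y] = 0 -> (fiber x F^`()).[y] != 0 ->
       `|(fiber x W).[y]| <= K * `|(fiber x F^`()).[y]| /\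
       `|x * (fiber x W).[y]| <= K * `|(fiber x F^`()).[y]|) ->
  exists2 D : {poly C}, D != 0 & forall x y, D.[x] != 0 -> (fiber x F).[y] = 0 ->
    (fiber x F^`()).[y] != 0 /\ (fiber x W).[y] = 0.
Proof.
move=> mF szF sepF K0 bndW; have [M defM] := ex_char_poly mF szF.
pose N q := \det (horner_mx M q).
pose D := N F^`().
have D0 : D != 0.
  move: sepF; rewrite separable_poly.unlock => /Bezout_coprimepP[[u v] /=].
  rewrite -size_poly_eq1 => /size_poly1P[c c0 E].
  apply: contraNneq c0 => D0; suff : c ^+ n.+1 = 0.
    by move/eqP; rewrite expf_eq0 => /andP[].
  have := congr1 N E; rewrite /N rmorphD !rmorphM /= -{1}defM Cayley_Hamilton mulr0 add0r.
  by rewrite det_mulmx -/(N F^`()) -/D D0 mulr0 horner_mx_C det_scalar.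
have NE x rs q : fiber x F = \prod_(r <- rs) ('X - r%:P) ->
    (N q).[x] = \prod_(r <- rs) (fiber x q).[r].
  move=> defrs; rewrite -horner_evalE -det_map_mx map_horner_mx.
  by apply: det_horner_mx; rewrite -map_char_poly defM.
have simple x y rs : fiber x F = \prod_(r <- rs) ('X - r%:P) -> D.[x] != 0 ->
    y \in rs -> (fiber x F^`()).[y] != 0.
  move=> defrs; rewrite (NE _ _ _ defrs) => + yrs; apply: contraNneq => F'y.
  by rewrite (perm_big _ (perm_to_rem yrs)) big_cons F'y /= mul0r.
have fiberQ x y t : (fiber x (t%:P%:P * F^`() - W)).[y] =
    t * (fiber x F^`()).[y] - (fiber x W).[y].
  rewrite rmorphB rmorphM /= hornerD hornerN hornerM /fiber map_polyC /=.
  by rewrite horner_evalE !hornerC.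
(* The factor X - al records the decay at infinity: it forces the constant in
   the Liouville theorem to vanish, as D does not vanish at al. *)
have [al Dal] := ex_nonroot D0.
have QE t : N (t%:P%:P * F^`() - W) = t ^+ n.+1 *: D.
  pose G := N (t%:P%:P * F^`() - W) - t ^+ n.+1 *: D.
  have K'0 : 0 <= (1 + `|al|) * K by rewrite mulr_ge0 ?addr_ge0.
  have [B B0 hB] := prod_shift_bound n.+1 t K'0.
  have [|c Ec] := bounded_ratio_const (P := ('X - al%:P) * G) D0 B0.
    move=> x Dx; have [rs defrs szrs] := fiber_roots x mF szF.
    pose h y := (fiber x W).[y] / (fiber x F^`()).[y].
    have -> : (('X - al%:P) * G).[x] =
        (x - al) * (\prod_(r <- rs) (t - h r) - t ^+ n.+1) * D.[x].
      rewrite hornerM hornerXsubC -mulrA; congr (_ * _).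
      rewrite hornerD hornerN hornerZ mulrBl !(NE _ _ _ defrs); congr (_ - _).
      rewrite -big_split /= big_seq [RHS]big_seq; apply: eq_bigr => r rrs.
      by rewrite fiberQ mulrBl divfK // (simple _ _ _ defrs).
    rewrite normrM ler_wpM2r //; apply: hB => // r rrs.
    have F'r := simple _ _ _ defrs Dx rrs.
    have Fr : (fiber x F).[r] = 0 by apply/rootP; rewrite defrs root_prod_XsubC.
    have [h1 h2] := bndW x r Fr F'r.
    have hr : `|h r| <= K by rewrite normf_div ler_pdivrMr ?normr_gt0.
    have xhr : `|x * h r| <= K by rewrite mulrA normf_div ler_pdivrMr ?normr_gt0.
    split; first by rewrite (le_trans hr) // mulrDl mul1r lerDl mulr_ge0.
    rewrite mulrBl (le_trans (ler_normB _ _)) // mulrDl mul1r lerD // normrM.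
    by rewrite ler_wpM2l.
  have c0 : c = 0.
    have := congr1 (fun p => p.[al]) Ec; rewrite hornerM hornerXsubC subrr mul0r.
    by rewrite hornerZ => /esym/eqP; rewrite mulf_eq0 (negPf Dal) orbF => /eqP.
  move/eqP: Ec; rewrite c0 scale0r mulf_eq0 polyXsubC_eq0 /=.
  by rewrite subr_eq0 => /eqP.
exists D => // x y Dx Fxy.
have [rs defrs szrs] := fiber_roots x mF szF.
have yrs : y \in rs by rewrite -root_prod_XsubC -defrs /root Fxy.
have F'y := simple _ _ _ defrs Dx yrs.
(* t is the value of h at the point (x, y), which is then a zero of the norm. *)
split=> //; pose t := (fiber x W).[y] / (fiber x F^`()).[y].
have : (N (t%:P%:P * F^`() - W)).[x] = 0.
  rewrite (NE _ _ _ defrs) (perm_big _ (perm_to_rem yrs)) big_cons /=.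
  by rewrite fiberQ divfK // subrr mul0r.
rewrite QE hornerZ => /eqP; rewrite mulf_eq0 (negPf Dx) orbF expf_eq0 /=.
by rewrite mulf_eq0 invr_eq0 (negPf F'y) orbF => /eqP.
Qed.

(** Over a point x with D x <> 0 the fibre consists of n distinct points, too
    many for the degree of V in y. *)
Lemma eq0_of_fiber_vanish n F V (D : {poly C}) :
    F \is monic -> size F = n.+1 -> D != 0 -> (size V <= n)%N ->
    (forall x y, D.[x] != 0 -> (fiber x F).[y] = 0 ->
       (fiber x F^`()).[y] != 0 /\ (fiber x V).[y] = 0) ->
  V = 0.
Proof.
move=> mF szF D0 szV hV.
have Vx x : D.[x] != 0 -> fiber x V = 0.
  move=> Dx; have [rs defrs szrs] := fiber_roots x mF szF.
  apply: (@roots_geq_poly_eq0 _ _ rs).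
  - apply/allP => r rrs; apply/rootP; apply: (hV _ _ Dx _).2.
    by apply/rootP; rewrite defrs root_prod_XsubC.
  - rewrite -separable_prod_XsubC -defrs separable_poly.unlock.
    apply/Pdiv.ClosedField.coprimepP => r Fr; rewrite /fiber deriv_map.
    by have /rootP/(hV _ _ Dx)[] := Fr.
  - by rewrite szrs (leq_trans _ szV) // size_poly.
apply/polyP => k; rewrite coef0; apply/eqP.
have: D * V`_k = 0.
  apply: horner_eq0 => x; rewrite hornerM; have [->|Dx] := eqVneq D.[x] 0.
    by rewrite mul0r.
  have := congr1 (fun p : {poly C} => p`_k) (Vx x Dx).
  by rewrite coef_map /= coef0 /horner_eval => ->; rewrite mulr0.
by move/eqP; rewrite mulf_eq0 (negPf D0).
Qed.

End Spectral.

(** * Uniform estimates by compactness *)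

Section Compactness.
Local Open Scope classical_set_scope.

Lemma normc_le_ReIm (R : rcfType) (a b : R) : `|a +i* b| <= (`|a| + `|b|)%:C.
Proof.
have -> : a +i* b = a%:C + 'i * b%:C by rewrite [LHS]complexE.
rewrite (le_trans (ler_normD _ _)) // normrM !normc_def /= expr1n.
by rewrite expr0n /= !add0r !addr0 sqrtr1 mul1r !sqrtr_sqr -rmorphD.
Qed.

Lemma normc_ge_Im (R : rcfType) (x : R[i]) : `|complex.Im x|%:C <= `|x|.
Proof.
have := normc_ge_Re (x * 'i); rewrite ReiNIm normrN normrM.
by rewrite [X in _ * X]normc_def /= expr1n expr0n /= add0r sqrtr1 mulr1.
Qed.

(** Compactness of the closed unit polydisc, for properties with a bound K:
    a bound that exists near every point can be chosen uniformly. *)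
Lemma cube_uniform (R : realType) n (Q : R -> ('I_n -> R[i]) -> Prop) :
    (forall K K' w, K <= K' -> Q K w -> Q K' w) ->
    (forall v, exists2 e : R[i], 0 < e & exists K, forall w,
       (forall j, `|w j - v j| < e) -> Q K w) ->
  exists K, forall w, (forall j, `|w j| <= 1) -> Q K w.
Proof.
move=> monQ locQ.
pose A := [set u : 'rV[R]_(n + n) | forall i, `[-1, 1]%classic (u ord0 i)].
have cA : compact A.
  apply: (@rV_compact R (n + n) (fun=> `[-1, 1]%classic)) => i.
  exact: segment_compact.
(* Real and imaginary parts identify C^n with R^(n + n). *)
pose toC (u : 'rV[R]_(n + n)) (j : 'I_n) : R[i] :=
  u ord0 (lshift n j) +i* u ord0 (rshift n j).
have [|K [_ hK]] := (compact_near_coveringP A).1 cA R +oo%R (fun K u => Q K (toC u)) _.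
  move=> u Au; have [e e0 [K hK]] := locQ (toC u).
  move: e0 hK; case: e => a b; rewrite ltcE /= => /andP[/eqP-> a0] hK.
  exists (ball u (a / 2), [set K' | K <= K']).
    split; last by apply: nbhs_pinfty_ge; rewrite num_real.
    by apply: nbhsx_ballx; rewrite divr_gt0.
  move=> [u' K'] [/= [_ uu'] KK']; apply: monQ KK' _; apply: hK => j.
  have h1 := uu' ord0 (lshift n j); have h2 := uu' ord0 (rshift n j).
  have -> : toC u' j - toC u j = (u' ord0 (lshift n j) - u ord0 (lshift n j)) +i*
    (u' ord0 (rshift n j) - u ord0 (rshift n j)) by rewrite /toC; simpc.
  apply: le_lt_trans (normc_le_ReIm _ _) _; rewrite ltcR [ltRHS]splitr.
  by rewrite ltrD // distrC.
exists (K + 1) => w hw.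
have := hK (K + 1); rewrite ltrDl ltr01.
move=> /(_ isT (row_mx (\row_j complex.Re (w j)) (\row_j complex.Im (w j)))).
rewrite (_ : toC _ = w); last first.
  by apply/funext => j; rewrite /toC row_mxEl row_mxEr !mxE; case: (w j).
apply=> j /=; rewrite in_itv /= -ler_norml -lecR.
case: (split_ordP j) => k ->; rewrite ?row_mxEl ?row_mxEr mxE (le_trans _ (hw k)) //.
  exact: normc_ge_Re.
exact: normc_ge_Im.
Qed.

End Compactness.

Section LocalBounds.
Variables (C : numFieldType) (n : nat).
Implicit Types (p : {mpoly C[n]}) (u v : 'I_n -> C).

Definition norm1 u : C := \sum_j `|u j|.

Lemma norm1_ge0 u : 0 <= norm1 u.
Proof. exact: sumr_ge0. Qed.

Lemma ler_norm1 u j : `|u j| <= norm1 u.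
Proof. by rewrite /norm1 (bigD1 j) //= lerDl sumr_ge0. Qed.

Lemma ler_norm_dot (a : 'I_n -> C) u : `|\sum_j a j * u j| <= norm1 a * norm1 u.
Proof.
rewrite (le_trans (ler_norm_sum _ _ _)) // mulr_suml ler_sum // => j _.
by rewrite normrM ler_wpM2l // ler_norm1.
Qed.

Lemma taylor_bound p v : exists2 K : C, 0 <= K & forall u, norm1 u <= 1 ->
  `|p.@[fun j => v j + u j] - p.@[v] - \sum_j (p^`M(j)).@[v] * u j| <= K * norm1 u ^+ 2.
Proof.
elim/mpoly_indXD: p => [c|p q [K K0 hK] [L L0 hL]|i p [K K0 hK]].
- exists 0 => // u _; rewrite !mevalC subrr big1 => [|j _].
    by rewrite subr0 normr0 mul0r.
  by rewrite mderivC meval0 mul0r.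
- exists (K + L); first exact: addr_ge0.
  move=> u hu; rewrite mulrDl; apply: le_trans (lerD (hK u hu) (hL u hu)).
  apply: le_trans (ler_normD _ _); rewrite !mevalD le_eqVlt; apply/orP; left.
  apply/eqP; congr `|_|.
  under eq_bigr => j _ do rewrite mderivD mevalD mulrDl.
  by rewrite big_split /=; ring.
pose a j := (p^`M(j)).@[v].
exists ((`|v i| + 1) * K + norm1 a).
  by rewrite addr_ge0 ?mulr_ge0 ?addr_ge0 ?norm1_ge0.
have dot_XM u : \sum_j (('X_i * p)^`M(j)).@[v] * u j =
    p.@[v] * u i + v i * \sum_j a j * u j.
  under eq_bigr => j _ do
    rewrite mderivM mderiv_XU mevalD !mevalM mevalXU mulrDl -mulrA -mulrA.
  rewrite big_split /= -mulr_sumr (bigD1 i) //= eqxx rmorph1 mul1r big1 ?addr0 //.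
  by move=> j /negPf ji; rewrite eq_sym ji rmorph0 mul0r.
move=> u hu; have := hK u hu; rewrite dot_XM !mevalM !mevalXU -/a.
set S := \sum_j _; set P := p.@[_]; set P0 := p.@[v] => hR.
have -> : (v i + u i) * P - v i * P0 - (P0 * u i + v i * S) =
  (v i + u i) * (P - P0 - S) + u i * S by ring.
rewrite (le_trans (ler_normD _ _)) // [leRHS]mulrDl lerD // normrM.
  rewrite -mulrA ler_pM // (le_trans (ler_normD _ _)) // lerD2l.
  by rewrite (le_trans (ler_norm1 _ _)).
rewrite expr2 mulrA mulrC ler_pM ?ler_norm1 // .
exact: ler_norm_dot.
Qed.

Lemma lipschitz_bound p v : exists2 K : C, 0 <= K & forall u, norm1 u <= 1 ->
  `|p.@[fun j => v j + u j] - p.@[v]| <= K * norm1 u.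
Proof.
have [K K0 hK] := taylor_bound p v; pose a j := (p^`M(j)).@[v].
exists (K + norm1 a); first by rewrite addr_ge0 ?norm1_ge0.
move=> u hu; rewrite -[X in `|X|](subrK (\sum_j a j * u j)).
rewrite (le_trans (ler_normD _ _)) // mulrDl lerD ?ler_norm_dot //.
rewrite (le_trans (hK u hu)) // ler_wpM2l // expr2 -[leRHS]mulr1.
by rewrite ler_wpM2l ?norm1_ge0.
Qed.

Variables (m : nat) (g : 'I_m -> {mpoly C[n]}).

Lemma bound_near_nonzero (w : {mpoly C[n]}) v (i : 'I_m) : (g i).@[v] != 0 ->
  exists2 e : C, 0 < e & exists2 K : C, 0 <= K & forall u, norm1 u <= e ->
    `|w.@[fun j => v j + u j]| <= K * \sum_j `|(g j).@[fun j => v j + u j]|.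
Proof.
move=> gv; pose a := `|(g i).@[v]|; have a0 : 0 < a by rewrite normr_gt0.
have [K K0 hK] := lipschitz_bound (g i) v.
have [L L0 hL] := lipschitz_bound w v.
have d0 : 0 < 2 * (K + 1) + a by rewrite addr_gt0 // mulr_gt0 // ltr_wpDl.
exists (a / (2 * (K + 1) + a)); first exact: divr_gt0.
exists ((`|w.@[v]| + L) / (a / 2)).
  by rewrite divr_ge0 ?addr_ge0 // ltW ?divr_gt0.
move=> u hu; have u1 : norm1 u <= 1.
  rewrite (le_trans hu) // ler_pdivrMr // mul1r lerDr mulr_ge0 // addr_ge0 //.
have ga : a / 2 <= \sum_j `|(g j).@[fun j => v j + u j]|.
  rewrite (bigD1 i) //=; apply: ler_wpDr; first exact: sumr_ge0.
  have gi := hK u u1; rewrite -[X in X <= _](addrK (a / 2)) -splitr.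
  have small : K * norm1 u <= a / 2.
    rewrite (le_trans (ler_wpM2l K0 hu)) // mulrA ler_pdivrMr //.
    rewrite mulrAC ler_pdivlMr // -subr_ge0.
    by rewrite (_ : _ - _ = a * (2 + a)) ?mulr_ge0 ?addr_ge0 ?(ltW a0) //; ring.
  rewrite lerBlDr -lerBlDl (le_trans _ small) // (le_trans _ gi) //.
  by rewrite distrC lerB_dist.
rewrite mulrAC ler_pdivlMr ?divr_gt0 //; apply: ler_pM => //.
  by rewrite ltW ?divr_gt0.
rewrite -[w.@[fun j => _]](subrK w.@[v]) (le_trans (ler_normD _ _)) // addrC lerD2l.
by rewrite (le_trans (hL u u1)) // -[leRHS]mulr1 ler_wpM2l.
Qed.

(** Where all g l vanish to first order only, in the sense that their linear
    parts control the size of the increment u, the sum of the |g l| is at least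
    proportional to |u|, whereas w = O(u). The predicate P is there to restrict
    u to a hyperplane: homogeneous forms that vanish at v vanish on the whole
    line through v, so no such control is possible in that direction. *)
Lemma bound_near_zero (w : {mpoly C[n]}) v (P : ('I_n -> C) -> Prop) (c : C) :
    w.@[v] = 0 -> (forall l, (g l).@[v] = 0) -> 0 <= c ->
    (forall u, P u -> norm1 u <= c * \sum_l `|\sum_j ((g l)^`M(j)).@[v] * u j|) ->
  exists2 e : C, 0 < e & exists2 K : C, 0 <= K & forall u, P u -> norm1 u <= e ->
    `|w.@[fun j => v j + u j]| <= K * \sum_l `|(g l).@[fun j => v j + u j]|.
Proof.
move=> wv gv c0 hc; have [L L0 hL] := lipschitz_bound w v.
have [S S0 hS] := fin_all_exists2 (fun l => taylor_bound (g l) v).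
pose T := \sum_l S l; have T0 : 0 <= T by apply: sumr_ge0.
have cT0 : 0 <= c * T by rewrite mulr_ge0.
have d0 : 0 < 1 + 2 * (c * T) by rewrite ltr_wpDr // mulr_ge0.
exists (1 + 2 * (c * T))^-1; first by rewrite invr_gt0.
exists (L * (2 * c)); first by rewrite !mulr_ge0.
move=> u Pu hu; have u1 : norm1 u <= 1.
  by rewrite (le_trans hu) // invf_le1 // lerDl mulr_ge0.
set G := \sum_l `|(g l).@[fun j => v j + u j]|.
have lin : \sum_l `|\sum_j ((g l)^`M(j)).@[v] * u j| <= G + T * norm1 u ^+ 2.
  rewrite /T mulr_suml -big_split /=; apply: ler_sum => l _.
  have := hS l u u1; rewrite gv subr0 => h; rewrite -lerBlDl (le_trans _ h) //.
  by rewrite distrC lerB_dist.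
have half : c * T * norm1 u ^+ 2 <= norm1 u / 2.
  rewrite expr2 mulrA mulrC ler_wpM2l ?norm1_ge0 //.
  rewrite (le_trans (ler_wpM2l cT0 hu)) // ler_pdivrMr // ler_pdivlMl //.
  by rewrite lerDr.
have {}hu : norm1 u <= 2 * c * G.
  rewrite -mulrA -ler_pdivrMl // -[leLHS](addrK (norm1 u / 2)) mulrC -splitr.
  rewrite lerBlDr (le_trans (hc u Pu)) // (le_trans (ler_wpM2l c0 lin)) //.
  by rewrite mulrDr mulrA lerD2l.
have := hL u u1; rewrite wv subr0 => /le_trans; apply.
by rewrite -mulrA ler_wpM2l.
Qed.

End LocalBounds.

Lemma ex_max_norm (R : rcfType) n (v : 'I_n.+1 -> R[i]) :
  exists i, forall j, `|v j| <= `|v i|.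
Proof.
case: (@Order.TotalTheory.arg_maxP _ _ _ (ord0 : 'I_n.+1) xpredT
  (fun i => complex.Re `|v i|) isT) => i _ hi.
by exists i => j; rewrite -[leLHS]RRe_real // -[leRHS]RRe_real // lecR; apply: hi.
Qed.

(** Every point of projective space has a representative in the closed unit
    polydisc with some coordinate equal to 1; compactness of the polydisc gives
    a bound on these representatives, and homogeneity extends it to all v. The
    difference of degrees accounts for the factor |v j|. *)
Lemma global_bound (R : realType) n m d (w : {mpoly R[i][n.+1]})
    (g : 'I_m -> {mpoly R[i][n.+1]}) :
    w \is d.-homog -> (forall l, g l \is d.+1.-homog) ->
    (forall v i, v i = 1 -> (forall l, (g l).@[v] = 0) -> w.@[v] = 0 /\
       exists2 c, 0 <= c & forall u, u i = 0 ->
         norm1 u <= c * \sum_l `|\sum_j ((g l)^`M(j)).@[v] * u j|) ->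
  exists2 K : R[i], 0 <= K &
    forall v j, `|v j| * `|w.@[v]| <= K * \sum_l `|(g l).@[v]|.
Proof.
move=> hw hg nondeg; pose G v := \sum_l `|(g l).@[v]|.
have G0 v : 0 <= G v by apply: sumr_ge0.
have chart i : exists2 K : R[i], 0 <= K & forall v, v i = 1 ->
    (forall j, `|v j| <= 1) -> `|w.@[v]| <= K * G v.
  pose Q (K : R) v := v i = 1 -> `|w.@[v]| <= K%:C * G v.
  have [|v|K hK] := @cube_uniform R n.+1 Q.
  - move=> K K' v leK hQ vi; apply: le_trans (hQ vi) _.
    by rewrite ler_wpM2r // lecR.
  (* Near a point outside the affine chart v i = 1 there is nothing to show. *)
  - have [vi|vi] := eqVneq (v i) 1; last first.
      exists `|v i - 1|; first by rewrite normr_gt0 subr_eq0.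
      by exists 0 => u /(_ i) + ui; rewrite ui distrC ltxx.
    have [e e0 [K K0 hK]] : exists2 e : R[i], 0 < e & exists2 K : R[i], 0 <= K &
        forall u, u i = 0 -> norm1 u <= e ->
          `|w.@[fun j => v j + u j]| <= K * G (fun j => v j + u j).
      have [/forallP gv|/forallPn[l gv]] := boolP [forall l, (g l).@[v] == 0].
        have [wv [c c0 hc]] := nondeg v i vi (fun l => eqP (gv l)).
        exact: (@bound_near_zero _ _ _ _ _ _ (fun u => u i = 0) c wv (fun l => eqP (gv l))).
      have [e e0 [K K0 hK]] := bound_near_nonzero w gv.
      by exists e => //; exists K => // u _; apply: hK.
    exists (e / n.+1%:R); first by rewrite divr_gt0 ?ltr0n.
    exists (complex.Re K) => u hu ui; rewrite RRe_real ?ger0_real //.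
    have := hK (fun j => u j - v j); rewrite ui vi subrr => /(_ erefl).
    have -> : (fun j => v j + (u j - v j)) = u.
      by apply/funext => j; rewrite addrC subrK.
    apply; rewrite /norm1 (le_trans (ler_sum _ (fun j _ => ltW (hu j)))) //.
    by rewrite sumr_const card_ord -[leLHS]mulr_natr divfK ?pnatr_eq0.
  exists `|K|%:C; first by rewrite lecR.
  move=> v vi hv; apply: le_trans (hK v hv vi) _.
  by rewrite ler_wpM2r // lecR ler_norm.
have [K K0 hK] := fin_all_exists2 chart.
exists (\sum_i K i); first exact: sumr_ge0.
move=> v j; rewrite -/(G v); have [i vmax] := ex_max_norm v.
have [vi|vi] := eqVneq (v i) 0.
  have /eqP -> : `|v j| == 0 by rewrite eq_le normr_ge0 andbT (le_trans (vmax j)) // vi normr0.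
  by rewrite mul0r mulr_ge0 ?sumr_ge0.
pose u l := v l / v i.
have vE : v = fun l => v i * u l by apply/funext => l; rewrite mulrC divfK.
have -> : G v = `|v i| ^+ d.+1 * G u.
  rewrite /G mulr_sumr; apply: eq_bigr => l _.
  by rewrite {1}vE (meval_dhomogZ _ _ (hg l)) normrM normrX.
rewrite {2}vE (meval_dhomogZ _ _ hw) normrM normrX.
have hu : `|w.@[u]| <= (\sum_i K i) * G u.
  apply: le_trans (hK i u _ _) _; first by rewrite /u divff.
    by move=> l; rewrite normf_div ler_pdivrMr ?normr_gt0 // mul1r.
  by rewrite ler_wpM2r // (bigD1 i) //= lerDl sumr_ge0.
rewrite [leLHS]mulrA [leRHS]mulrCA exprS; apply: ler_pM => //.
by rewrite ler_wpM2r ?exprn_ge0.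
Qed.

(** A linear map that is injective on the hyperplane u i = 0 has a left inverse
    there, whose coefficients give the bound. *)
Lemma injective_bound (K : numFieldType) n m (A : 'I_m -> 'I_n -> K) (i : 'I_n) :
    (forall u, u i = 0 -> (forall l, \sum_j A l j * u j = 0) -> forall j, u j = 0) ->
  exists2 c : K, 0 <= c & forall u, u i = 0 ->
    norm1 u <= c * \sum_l `|\sum_j A l j * u j|.
Proof.
move=> inj; pose M : 'M_(n, m + 1) := row_mx (\matrix_(j, l) A l j) (delta_mx i 0).
have uMl (u : 'I_n -> K) l : ((\row_j u j) *m M) 0 (lshift 1 l) = \sum_j A l j * u j.
  by rewrite !mxE; apply: eq_bigr => j _; rewrite row_mxEl !mxE mulrC.
have uMr (u : 'I_n -> K) : ((\row_j u j) *m M) 0 (rshift m 0) = u i.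
  rewrite !mxE (bigD1 i) //= big1 => [|j /negPf ji].
    by rewrite row_mxEr !mxE !eqxx mulr1 addr0.
  by rewrite row_mxEr !mxE ji mulr0.
have /row_freeP[L ML] : row_free M.
  apply: inj_row_free => v vM; apply/rowP => j; rewrite mxE.
  have vE : v = \row_j v 0 j by apply/rowP => k; rewrite mxE.
  apply: (inj (fun j => v 0 j)) => [|l].
    by rewrite -(uMr (fun j => v 0 j)) -vE vM mxE.
  by rewrite -(uMl (fun j => v 0 j)) -vE vM mxE.
exists (\sum_j \sum_k `|L k j|).
  by apply: sumr_ge0 => j _; apply: sumr_ge0.
move=> u ui; rewrite /norm1 mulr_suml; apply: ler_sum => j _.
have -> : u j = \sum_k ((\row_j u j) *m M) 0 k * L k j.
  have : (\row_j u j) *m M *m L = \row_j u j by rewrite -mulmxA ML mulmx1.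
  by move/rowP/(_ j); rewrite mxE [RHS]mxE => ->.
rewrite (le_trans (ler_norm_sum _ _ _)) // mulr_suml; apply: ler_sum => k _.
rewrite normrM mulrC ler_wpM2l //; case: (split_ordP k) => l ->.
  by rewrite uMl (bigD1 l) //= lerDl sumr_ge0.
by rewrite (ord1 l) uMr ui normr0 sumr_ge0.
Qed.

(** * Nodes have a nondegenerate Hessian *)

Lemma free2P (K : fieldType) (V : vectType K) (u v : V) (a b : K) :
  free [:: u; v] -> a *: u + b *: v = 0 -> a = 0 /\ b = 0.
Proof.
rewrite free_cons span_seq1 seq1_free => /andP[uv v0].
have [-> /eqP|a0 /eqP] := eqVneq a 0.
  by rewrite scale0r add0r scaler_eq0 (negPf v0) orbF => /eqP.
rewrite addr_eq0 => /eqP/(congr1 (fun w => a^-1 *: w)); rewrite scalerA mulVf // scale1r => E.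
by move: uv; rewrite E -scaleNr scalerA memvZ ?memv_line.
Qed.

Lemma sum_ord2 (V : nmodType) (F : 'I_2 -> V) : \sum_i F i = F 0 + F 1.
Proof.
rewrite big_ord_recl big_ord1; congr (F _ + F _); exact: val_inj.
Qed.

Lemma mderiv2_mul_at0 n (K : comNzRingType) (p q : {mpoly K[n]}) i j :
    p.@[fun=> 0] = 0 -> q.@[fun=> 0] = 0 ->
  ((p * q)^`M(i)^`M(j)).@[fun=> 0] =
    (p^`M(i)).@[fun=> 0] * (q^`M(j)).@[fun=> 0]
    + (p^`M(j)).@[fun=> 0] * (q^`M(i)).@[fun=> 0].
Proof.
move=> p0 q0; rewrite mderivM mderivD 2!mderivM 3!mevalD 4!mevalM p0 q0.
by rewrite mulr0 mul0r add0r addr0.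
Qed.

Lemma linear_form2 (K : comNzRingType) (p : {mpoly K[2]}) : p \is 1.-homog ->
  p = (p^`M(0)).@[fun=> 0] *: 'X_0 + (p^`M(1)).@[fun=> 0] *: 'X_1.
Proof.
move=> hp; have c k : p^`M(k) = (p^`M(k)).@[fun=> 0]%:MP.
  by rewrite [LHS](dhomog0_const (dhomog_mderiv k hp)) meval_at0.
rewrite -[LHS]mulr1n -(euler_dhomog hp) sum_ord2.
by rewrite [X in _ * X + _]c [X in _ + _ * X]c ![_ * _%:MP]mulrC !mul_mpolyC.
Qed.

Lemma linear_form2_comb (K : comNzRingType) (p q : {mpoly K[2]}) (x y : K) :
    p \is 1.-homog -> q \is 1.-homog ->
    (forall l, x * (p^`M(l)).@[fun=> 0] + y * (q^`M(l)).@[fun=> 0] = 0) ->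
  x *: p + y *: q = 0.
Proof.
move=> hp hq h; rewrite (linear_form2 hp) (linear_form2 hq).
rewrite 2!scalerDr 4!scalerA addrACA -2!scalerDl.
by rewrite (h 0) (h 1) 2!scale0r addr0.
Qed.

(** The symmetric matrix a b^T + b a^T of the quadratic form with factors a and
    b is invertible when a and b are independent. *)
Lemma sym_rank2_kernel (K : fieldType) (a b t : 'I_2 -> K) :
    (forall x y, (forall l, x * a l + y * b l = 0) -> x = 0 /\ y = 0) ->
    (forall l, \sum_k (a l * b k + a k * b l) * t k = 0) ->
  forall l, t l = 0.
Proof.
move=> ind ht; pose A := a 0 * t 0 + a 1 * t 1; pose B := b 0 * t 0 + b 1 * t 1.
have [B0 A0] : B = 0 /\ A = 0.
  by apply: ind => l; rewrite -[RHS](ht l) sum_ord2 /A /B; ring.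
have I2 (k : 'I_2) : (k == 0) || (k == 1) by case: k => [[|[|]]].
pose D := a 0 * b 1 - a 1 * b 0.
have tD l : t l * D = 0.
  case/orP: (I2 l) => /eqP ->.
    have -> : t 0 * D = b 1 * A - a 1 * B by rewrite /A /B /D; ring.
    by rewrite A0 B0 !mulr0 subr0.
  have -> : t 1 * D = a 0 * B - b 0 * A by rewrite /A /B /D; ring.
  by rewrite A0 B0 !mulr0 subr0.
move=> l; have /eqP := tD l; rewrite mulf_eq0 => /orP[/eqP //|/eqP D0].
have [b0 /eqP] : b 0 = 0 /\ - a 0 = 0.
  apply: ind => k; case/orP: (I2 k) => /eqP ->; first by ring.
  by rewrite -[RHS]oppr0 -D0 /D; ring.
rewrite oppr_eq0 => /eqP a0.
have [b1 /eqP] : b 1 = 0 /\ - a 1 = 0.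
  apply: ind => k; case/orP: (I2 k) => /eqP ->; last by ring.
  by rewrite -[RHS]D0 /D; ring.
rewrite oppr_eq0 => /eqP a1.
have [|/eqP] := ind 1 0; last by rewrite oner_eq0.
by move=> k; rewrite mul0r addr0 mul1r; case/orP: (I2 k) => /eqP ->.
Qed.

(** All singular points are ordinary double points, in a form that does not
    refer to a chart. At a singular point v the Hessian kills v by Euler's
    relation, so its rank is at most 2; the condition says that it is 2, which
    is the rank of the Hessian of a chart when the tangent cone consists of two
    distinct lines. *)
Definition nondegenerate (K : fieldType) (f : {mpoly K[3]}) :=
  forall v, (exists i, v i != 0) -> (forall i, (f^`M(i)).@[v] = 0) ->
  forall u, (forall i, \sum_j (f^`M(i)^`M(j)).@[v] * u j = 0) ->
  exists s, forall j, u j = s * v j.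

Section Nodes.
Variable R : realType.
Local Notation C := (R[i]).
Implicit Types (f : {mpoly C[3]}) (g : {mpoly C[2]}) (u v : 'I_3 -> C).

Lemma mderiv2_at0 n (K : comNzRingType) (p : {mpoly K[n]}) i j :
  (p^`M(i)^`M(j)).@[fun=> 0] = ((pihomog mdeg 2 p)^`M(i)^`M(j)).@[fun=> 0].
Proof.
rewrite !meval_at0 !mcoeff_mderiv; congr (_ *+ _ *+ _).
rewrite add0m; set m := (_ + _)%MM.
have dm : mdeg m = 2 by rewrite mdegD !mdeg1.
rewrite {1}[p]mpolyE pihomogE !raddf_sum /= [RHS]big_mkcond /=.
apply: eq_bigr => m' _; rewrite !mcoeffZ mcoeffX; case: eqVneq => [->|_].
  by rewrite dm eqxx.
by rewrite mulr0 if_same.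
Qed.

(** The local coordinate l stands for the homogeneous coordinate [lift i l]. *)
Lemma mderiv_local_equation f v i l :
  (local_equation f v i)^`M(l) = local_equation f^`M(lift i l) v i.
Proof.
rewrite /local_equation; set t := [tuple _ | j < 3].
have /= -> := derivation_chain_rule (d := mderiv l) (phi := comp_mpoly t) _ _ f.
- rewrite (bigD1_ord i) //= (bigD1 l) //= big1 => [|k /negPf kl].
    rewrite !comp_mpolyXU -!tnth_nth !tnth_mktuple unlift_none liftK.
    by rewrite mderivC mul0r add0r addr0 mderivD mderivC add0r mderiv_XU eqxx mul1r.
  rewrite comp_mpolyXU -tnth_nth tnth_mktuple liftK mderivD mderivC add0r.
  by rewrite mderiv_XU kl mul0r.
- exact: mderivM.
- by move=> c; rewrite comp_mpolyC mderivC.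
Qed.

Lemma local_equation_at0 f v i : v i != 0 ->
  (local_equation f v i).@[fun=> 0] = f.@[fun j => (v i)^-1 * v j].
Proof.
move=> vi; rewrite /local_equation comp_mpoly_meval; apply: meval_eq => j.
rewrite tnth_mktuple; case: unliftP => [l|] ->.
  by rewrite mevalD mevalC mevalXU addr0 mulrC.
by rewrite meval1 mulVf.
Qed.

Lemma ordinary_double_point_hessian g (t : 'I_2 -> C) : ordinary_double_point g ->
    (forall l, \sum_k (g^`M(l)^`M(k)).@[fun=> 0] * t k = 0) ->
  forall l, t l = 0.
Proof.
case=> _ _ [l1 [l2 [free12 g2]]] ht.
pose co (l : dhomog 2 C 1) k := ((val l)^`M(k)).@[fun=> 0].
apply: (@sym_rank2_kernel _ (co l1) (co l2)) => [x y h | l].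
  apply: (free2P free12); apply: val_inj => /=.
  exact: (linear_form2_comb (dhomog_is_dhomog l1) (dhomog_is_dhomog l2)).
rewrite -[RHS](ht l); apply: eq_bigr => k _; congr (_ * _).
have z (l' : dhomog 2 C 1) : (val l').@[fun=> 0] = 0.
  by rewrite meval_at0 (dhomog_nemf_coeff (dhomog_is_dhomog l')) //= mdeg0.
by rewrite mderiv2_at0 g2 mderiv2_mul_at0.
Qed.

(** Given u in the kernel of the Hessian at v, subtract a multiple of v to make
    its i-th coordinate zero. The rest is killed by the Hessian of the local
    equation in the chart i, so it is zero. *)
Lemma node_nondegenerate d f : f \is d.+2.-homog ->
  (forall v, singular_point f v -> node f v) -> nondegenerate f.
Proof.
move=> hf nodes v v0 grad0 u Hu.
have sv : singular_point f v.
  split=> //; have := euler_meval v hf; rewrite big1 => [/esym/eqP|j _].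
    by rewrite mulf_eq0 pnatr_eq0 => /eqP.
  by rewrite grad0 mulr0.
have [i vi odp] := nodes v sv.
have fh k := dhomog_mderiv k hf; have fhh k l := dhomog_mderiv l (fh k).
exists (u i / v i) => j; apply/eqP; rewrite -subr_eq0; apply/eqP.
pose u' j := u j - u i / v i * v j; rewrite -/(u' j).
have u'i : u' i = 0 by rewrite /u' divfK // subrr.
have Hu' k : \sum_j (f^`M(k)^`M(j)).@[v] * u' j = 0.
  rewrite /u'; under eq_bigr => l _ do rewrite mulrBr mulrCA.
  rewrite sumrB Hu -mulr_sumr.
  under [\sum_(_ < _) _]eq_bigr => l _ do rewrite mulrC.
  by rewrite (euler_meval v (fh k)) grad0 !mulr0 subr0.
case: (unliftP i j) => [l|] -> //.
apply: (@ordinary_double_point_hessian _ (fun l => u' (lift i l)) odp) => {}l.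
under eq_bigr => k _.
  rewrite !mderiv_local_equation local_equation_at0 // (meval_dhomogZ _ _ (fhh _ _)) -mulrA.
  over.
rewrite -mulr_sumr.
have := Hu' (lift i l); rewrite (bigD1_ord i) //= u'i mulr0 add0r => ->.
by rewrite mulr0.
Qed.

End Nodes.

(** * Vector products *)

Section Cross.
Variable A : comNzRingType.
Implicit Types u v g : 'I_3 -> A.

Lemma ord3S3 (i : 'I_3) : i + 1 + 1 + 1 = i.
Proof. by apply: val_inj; case: i => [[|[|[|]]]]. Qed.

Lemma sum_ord3_at (V : nmodType) (i : 'I_3) (F : 'I_3 -> V) :
  \sum_j F j = F i + F (i + 1) + F (i + 1 + 1).
Proof.
rewrite (reindex_inj (addrI i)) 2!big_ord_recl big_ord1 /= addrA.
by congr (F _ + F _ + F _); apply: val_inj; case: i => [[|[|[|]]]].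
Qed.

Lemma ord3_at (i j : 'I_3) : [\/ j = i, j = i + 1 | j = i + 1 + 1].
Proof.
by case: i j => [[|[|[|]]]] // ? [[|[|[|]]]] // ?;
  [constructor 1 | constructor 2 | constructor 3 | constructor 3 | constructor 1
  | constructor 2 | constructor 2 | constructor 3 | constructor 1]; apply: val_inj.
Qed.

(** Indices are taken modulo 3, so that no coordinate is singled out. *)
Definition cross u v i := u (i + 1) * v (i + 1 + 1) - u (i + 1 + 1) * v (i + 1).

(** The vector product of u and v is proportional to g, both being orthogonal
    to u and v. *)
Lemma cross_orthogonal u v g : \sum_j u j * g j = 0 -> \sum_j v j * g j = 0 ->
  forall i j, cross u v i * g j = cross u v j * g i.
Proof.
have main i : \sum_j u j * g j = 0 -> \sum_j v j * g j = 0 ->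
    cross u v i * g (i + 1) = cross u v (i + 1) * g i.
  rewrite !(sum_ord3_at i) /cross !ord3S3 => hu hv; apply/eqP; rewrite -subr_eq0.
  set U := _ + _ in hu; set V := _ + _ in hv.
  have -> : (u (i + 1) * v (i + 1 + 1) - u (i + 1 + 1) * v (i + 1)) * g (i + 1) -
     (u (i + 1 + 1) * v i - u i * v (i + 1 + 1)) * g i =
     v (i + 1 + 1) * U - u (i + 1 + 1) * V by rewrite /U /V; ring.
  by rewrite hu hv !mulr0 subrr.
move=> hu hv i j; case: (ord3_at i j) => -> //; first exact: main.
by have := main (i + 1 + 1) hu hv; rewrite !ord3S3.
Qed.

Lemma cross_eq0 u v : (forall i, cross u v i = 0) -> forall i j, u i * v j = u j * v i.
Proof.
have main i : cross u v (i + 1 + 1) = 0 -> u i * v (i + 1) = u (i + 1) * v i.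
  by rewrite /cross !ord3S3 => /eqP; rewrite subr_eq0 => /eqP.
move=> h i j; case: (ord3_at i j) => -> //; first exact: main.
by have := main (i + 1 + 1) (h _); rewrite !ord3S3.
Qed.

End Cross.

(** * General lines through a point meet the curve transversally *)

Section DoubleFactor.
Variables (A : comNzRingType) (K : comNzRingType) (e : {rmorphism A -> K}).
Variables (d d' : {additive A -> A}).
Hypothesis dM : forall x y, d (x * y) = d x * y + x * d y.
Hypothesis d'M : forall x y, d' (x * y) = d' x * y + x * d' y.

(** At a zero of u, the second order part of a multiple of u ^ 2 is a multiple
    of the square of the differential of u. *)
Lemma double_factor_jet (c F q u : A) :
    c * F = q * u ^+ 2 -> e u = 0 -> e F = 0 -> e (d F) = 0 -> e (d' F) = 0 ->
  e c * e (d (d' F)) = 2 * e q * (e (d u) * e (d' u)).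
Proof.
move=> /(congr1 (fun x => e (d (d' x)))) + u0 F0 dF0 d'F0.
rewrite expr2 !(d'M, raddfD, dM) /= !(rmorphD, rmorphM) /= u0 F0 dF0 d'F0.
by rewrite !(mulr0, mul0r, add0r, addr0) => ->; ring.
Qed.

End DoubleFactor.

Lemma double_factor_grad (A : comNzRingType) (K : fieldType) (e : {rmorphism A -> K})
    (d : {additive A -> A}) (c F q u : A) :
    (forall x y, d (x * y) = d x * y + x * d y) ->
    c * F = q * u ^+ 2 -> e u = 0 -> e c != 0 -> e F = 0 /\ e (d F) = 0.
Proof.
move=> dM E u0 c0; have F0 : e F = 0.
  have /eqP := congr1 e E; rewrite expr2 !rmorphM /= u0 !mulr0 mulf_eq0.
  by rewrite (negPf c0) => /eqP.
split=> //; have /eqP := congr1 (fun x => e (d x)) E.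
rewrite expr2 !(dM, rmorphD, rmorphM) /= u0 F0 !(mulr0, mul0r, add0r, addr0) mulf_eq0.
by rewrite (negPf c0) => /eqP.
Qed.

Lemma deriv_coefM (K : comNzRingType) (p q : {poly {poly K}}) :
  map_poly deriv (p * q) = map_poly deriv p * q + p * map_poly deriv q.
Proof.
apply/polyP => k; rewrite coef_map /= coefD !coefM raddf_sum -big_split /=.
by apply: eq_bigr => i _; rewrite derivM !coef_map.
Qed.

Lemma separable_square_free (K : numDomainType) (F : {poly {poly K}}) :
    (forall u : {poly {poly K}}, (1 < size u)%N -> u ^+ 2 %| F -> False) -> F != 0 ->
  separable_poly F.
Proof.
move=> sqf F0; apply/separable_polyP; split.
  apply/poly_square_freeP => u u1; apply/negP => uF; apply: (sqf u) => //.
  have u0 : u != 0 by apply: contraNneq F0 => u0; move: uF; rewrite u0 expr0n dvd0p.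
  by rewrite ltn_neqAle eq_sym u1 size_poly_gt0.
move=> u _ szu; apply/eqP => u'0.
have /eqP := congr1 (fun p : {poly {poly K}} => p`_(size u).-2) u'0.
rewrite coef_deriv coef0 prednK; last by case: (size u) szu => [|[]].
rewrite -mulr_natr mulf_eq0 -[u`__]/(lead_coef u) lead_coef_eq0.
rewrite -polyC_natr polyC_eq0 pnatr_eq0 => /orP[/eqP u0|].
  by rewrite u0 size_poly0 in szu.
by case: (size u) szu => [|[]].
Qed.

Section Frame.
Variable C : numClosedFieldType.
Variable B : 'M[C]_3.
Hypothesis uB : B \in unitmx.

(** All lines through q = B 0 but one are parametrized by x, and the points of
    such a line other than q by y. *)
Definition point (x y : C) (j : 'I_3) : C := B 1 j + B (1 + 1) j * x + B 0 j * y.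

(** The pull-back of p along [point], as a polynomial in y over C[x]. *)
Definition restrict (p : {mpoly C[3]}) : {poly {poly C}} :=
  pencil polyC (fun j => (B 1 j)%:P + B (1 + 1) j *: 'X) (fun j => (B 0 j)%:P) p.

HB.instance Definition _ := GRing.RMorphism.copy restrict
  (pencil polyC (fun j => (B 1 j)%:P + B (1 + 1) j *: 'X) (fun j => (B 0 j)%:P)).

Lemma horner_restrict p x y : (fiber x (restrict p)).[y] = p.@[point x y].
Proof.
rewrite /fiber /restrict map_pencil horner_pencil /meval /mmap.
apply: eq_bigr => m _; congr (_ * _); first by rewrite /= horner_evalE hornerC.
apply: mmap1_eq => j /=.
by rewrite !horner_evalE hornerD !hornerC hornerZ hornerX.
Qed.

Lemma frame_free (c : 'I_3 -> C) : (forall j, \sum_k c k * B k j = 0) -> forall k, c k = 0.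
Proof.
move=> h k; have : (\row_k c k) *m B = 0.
  by apply/rowP => j; rewrite !mxE -[RHS](h j); apply: eq_bigr => l _; rewrite mxE.
move/(congr1 (mulmx^~ (invmx B))); rewrite mulmxK // mul0mx => /rowP/(_ k).
by rewrite !mxE.
Qed.

Lemma frame_total (g : 'I_3 -> C) : (forall k, \sum_j B k j * g j = 0) -> forall j, g j = 0.
Proof.
move=> h k; have : B *m (\col_k g k) = 0.
  by apply/colP => j; rewrite !mxE -[RHS](h j); apply: eq_bigr => l _; rewrite mxE.
move/(congr1 (mulmx (invmx B))); rewrite mulKmx // mulmx0 => /colP/(_ k).
by rewrite !mxE.
Qed.

Lemma frame_dual k l : \sum_j B k j * invmx B j l = (k == l)%:R.
Proof. by have := mulmxV uB => /matrixP/(_ k l); rewrite !mxE. Qed.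

Lemma frame_coord v : exists c, forall j, v j = \sum_k c k * B k j.
Proof.
exists (fun k => ((\row_j v j) *m invmx B) 0 k) => j.
have := mulmxKV uB (\row_j v j) => /rowP/(_ j); rewrite !mxE => <-.
by apply: eq_bigr => k _; rewrite mxE.
Qed.

Lemma deriv_y_restrict p : (restrict p)^`() = \sum_j restrict (B 0 j *: p^`M(j)).
Proof.
rewrite deriv_pencil; apply: eq_bigr => j _.
by rewrite -mul_mpolyC rmorphM /= /restrict pencilC mul_polyC.
Qed.

Lemma deriv_x_restrict p :
  map_poly deriv (restrict p) = \sum_j restrict (B (1 + 1) j *: p^`M(j)).
Proof.
have /= -> := @derivation_chain_rule _ _ _ (map_poly deriv) restrict _ _ p.
- apply: eq_bigr => j _; rewrite -mul_mpolyC rmorphM /= [restrict _%:MP]pencilC.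
  congr (_ * _); rewrite [restrict _]pencilX; apply/polyP => k.
  rewrite coef_map /= coefD !coefC coefZ coefX.
  case: k => [|[|k]] /=; rewrite ?mulr0 ?mulr1 ?addr0 ?add0r ?derivC ?deriv0 //.
  by rewrite derivD derivC derivZ derivX add0r alg_polyC.
- exact: deriv_coefM.
- by move=> c; rewrite [restrict _]pencilC map_polyC /= derivC.
Qed.

End Frame.

Section FrameJets.
Variable C : numClosedFieldType.
Variable B : 'M[C]_3.
Hypothesis uB : B \in unitmx.

Lemma frame3_free a b c : (forall j, a * B 0 j + b * B 1 j + c * B (1 + 1) j = 0) ->
  [/\ a = 0, b = 0 & c = 0].
Proof.
move=> h; pose w (k : 'I_3) := if k == 0 then a else if k == 1 then b else c.
have w0 : forall k, w k = 0.
  by apply: (frame_free uB) => j; rewrite (sum_ord3_at 0) add0r -[RHS](h j).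
by split; [exact: (w0 0) | exact: (w0 1) | exact: (w0 (1 + 1))].
Qed.

Lemma frame3_total x y (g : 'I_3 -> C) :
    \sum_j B 0 j * g j = 0 -> \sum_j B (1 + 1) j * g j = 0 ->
    \sum_j point B x y j * g j = 0 -> forall j, g j = 0.
Proof.
move=> h0 h2 hp; apply: (frame_total uB) => k.
case: (ord3_at 0 k) => ->; rewrite ?add0r //; move: hp.
under eq_bigr => j _ do rewrite /point !mulrDl mulrAC [_ * y * _]mulrAC.
by rewrite !big_split /= -!mulr_suml h0 h2 !mul0r !addr0.
Qed.

Lemma point_neq0 x y : exists i, point B x y i != 0.
Proof.
apply/existsP; apply: contraT; rewrite negb_exists => /forallP p0.
have [j|_ /eqP] := @frame3_free y 1 x; last by rewrite oner_eq0.
have /negPn/eqP E := p0 j; rewrite -[RHS]E /point; ring.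
Qed.

Definition derives (d : {poly {poly C}} -> {poly {poly C}}) (b : 'I_3 -> C) :=
  (forall p q, d (p * q) = d p * q + p * d q) /\
  (forall p, d (restrict B p) = \sum_j restrict B (b j *: p^`M(j))).

Lemma derives_y : derives deriv (B 0).
Proof. by split; [exact: derivM | exact: deriv_y_restrict]. Qed.

Lemma derives_x : derives (map_poly deriv) (B (1 + 1)).
Proof. by split; [exact: deriv_coefM | exact: deriv_x_restrict]. Qed.

Section Jet.
Variables x y : C.
Local Notation P := (point B x y).
Definition evalxy (q : {poly {poly C}}) : C := (fiber x q).[y].
HB.instance Definition _ := GRing.RMorphism.copy evalxy (horner_eval y \o fiber x).

Lemma evalxy_restrict p : evalxy (restrict B p) = p.@[P].
Proof. exact: horner_restrict. Qed.

Lemma evalxy_derives (d : {additive {poly {poly C}} -> {poly {poly C}}}) b p :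
  derives d b -> evalxy (d (restrict B p)) = \sum_j b j * (p^`M(j)).@[P].
Proof.
case=> _ ->; rewrite rmorph_sum; apply: eq_bigr => j _ /=.
by rewrite evalxy_restrict mevalZ.
Qed.

Lemma evalxy_derives2 (d d' : {additive {poly {poly C}} -> {poly {poly C}}}) b b' p :
    derives d b -> derives d' b' ->
  evalxy (d (d' (restrict B p))) =
    \sum_j b' j * \sum_k b k * (p^`M(j)^`M(k)).@[P].
Proof.
move=> db [_ ->]; rewrite raddf_sum rmorph_sum; apply: eq_bigr => j _ /=.
rewrite (evalxy_derives _ db) mulr_sumr; apply: eq_bigr => k _.
by rewrite mderivZ mevalZ mulrCA.
Qed.

(** At a zero P of the double factor u, f vanishes with its gradient. In the
    plane spanned by the directions of x and y, the Hessian of f at P is a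
    multiple of the square of the differential of u, so some direction v0 of
    that plane is orthogonal to the plane for the Hessian; it is orthogonal to P
    by Euler's relation. So v0 is in the kernel of the Hessian without being
    proportional to P. *)
Lemma no_double_factor d f c q u : f \is d.+2.-homog -> nondegenerate f ->
  c * restrict B f = q * u ^+ 2 -> evalxy u = 0 -> evalxy c != 0 -> False.
Proof.
move=> hf ndeg E u0 c0; pose dy : {additive _ -> _} := (@deriv {poly C}).
pose dx : {additive {poly {poly C}} -> {poly {poly C}}} := map_poly (@deriv C).
have Lx : forall p q, dx (p * q) = dx p * q + p * dx q by exact: deriv_coefM.
have Ly : forall p q, dy (p * q) = dy p * q + p * dy q by exact: derivM.
have [F0 Fx] := double_factor_grad Lx E u0 c0.
have [_ Fy] := double_factor_grad Ly E u0 c0.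
have Px : derives dx (B (1 + 1)) by exact: derives_x.
have Py : derives dy (B 0) by exact: derives_y.
have euler := euler_meval P hf.
have grad0 : forall j, (f^`M(j)).@[P] = 0.
  apply: (@frame3_total x y).
  - by rewrite -(evalxy_derives _ Py).
  - by rewrite -(evalxy_derives _ Px).
  - by rewrite euler -evalxy_restrict F0 mulr0.
have [[al be] /= [ab0 abU]] : exists ab : C * C,
    (ab.1 != 0 \/ ab.2 != 0) /\ ab.1 * evalxy (dx u) + ab.2 * evalxy (dy u) = 0.
  have [ux|ux] := eqVneq (evalxy (dx u)) 0.
    by exists (1, 0) => /=; rewrite oner_neq0 ux mulr0 mul0r addr0; split; [left |].
  by exists (- evalxy (dy u), evalxy (dx u)) => /=; rewrite ux; split; [right | ring].
(* (al, be) is a nonzero vector killed by the differential of u. *)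
pose v0 j := al * B (1 + 1) j + be * B 0 j.
have hdir (e : {additive {poly {poly C}} -> {poly {poly C}}}) b : derives e b ->
    \sum_k b k * \sum_j (f^`M(k)^`M(j)).@[P] * v0 j = 0.
  move=> eb; have [Le _] := eb.
  have jx := double_factor_jet Le Lx E u0 F0 _ Fx.
  have jy := double_factor_jet Le Ly E u0 F0 _ Fy.
  have [_ Fe] := double_factor_grad Le E u0 c0.
  have : evalxy c * (al * evalxy (e (dx (restrict B f)))
      + be * evalxy (e (dy (restrict B f)))) = 0.
    rewrite mulrDr !(mulrCA (evalxy c)) jx // jy //.
    rewrite -[RHS](mulr0 (2 * evalxy q * evalxy (e u))) -abU; ring.
  move/eqP; rewrite mulf_eq0 (negPf c0) /= => /eqP E0; rewrite -[RHS]E0.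
  rewrite (evalxy_derives2 _ eb Px) (evalxy_derives2 _ eb Py) !mulr_sumr -big_split /=.
  under eq_bigr => k _ do rewrite mulr_sumr.
  rewrite exchange_big; apply: eq_bigr => j _ /=.
  rewrite !mulr_sumr -big_split /=; apply: eq_bigr => k _.
  by rewrite mderiv_comm /v0; ring.
have Hv0 : forall k, \sum_j (f^`M(k)^`M(j)).@[P] * v0 j = 0.
  apply: (@frame3_total x y); [exact: (hdir _ _ Py) | exact: (hdir _ _ Px) |].
  under eq_bigr => k _ do rewrite mulr_sumr.
  rewrite exchange_big big1 // => j _ /=.
  under eq_bigr => k _ do rewrite mderiv_comm mulrA.
  by rewrite -mulr_suml (euler_meval P (dhomog_mderiv j hf)) grad0 mulr0 mul0r.
have [s hs] := ndeg P (point_neq0 x y) grad0 v0 Hv0.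
have [j|be0 s0 al0] := @frame3_free (be - s * y) (- s) (al - s * x).
  by have := hs j; rewrite /v0 /point => /eqP; rewrite -subr_eq0 => /eqP <-; ring.
move/eqP: s0; rewrite oppr_eq0 => /eqP s0; move: al0 be0; rewrite s0 !mul0r !subr0 => al0 be0.
by case: ab0 => /eqP.
Qed.

End Jet.

Lemma separable_restrict d f : f \is d.+2.-homog -> nondegenerate f ->
  restrict B f != 0 -> separable_poly (restrict B f).
Proof.
move=> hf ndeg F0; apply: separable_square_free F0 => u szu.
rewrite Pdiv.Idomain.dvdp_eq; set c := _ ^+ _ => /eqP E.
have u0 : u != 0 by rewrite -size_poly_gt0 (ltn_trans _ szu).
have c0 : c != 0 by rewrite /c Pdiv.Idomain.lc_expn_scalp_neq0.
have [x] : exists x, (c * lead_coef u).[x] != 0.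
  by apply: ex_nonroot; rewrite mulf_neq0 ?lead_coef_eq0.
rewrite hornerM mulf_eq0 negb_or => /andP[cx lx].
have szux : size (fiber x u) = size u by apply: size_map_poly_id0.
have [|y /rootP uy] := closed_rootP (fiber x u) _.
  by rewrite szux neq_ltn szu orbT.
apply: (@no_double_factor x y d f c%:P _ u hf ndeg _ uy).
  by rewrite mul_polyC E.
by rewrite /evalxy /fiber map_polyC hornerC.
Qed.

End FrameJets.

(** * Vanishing of foliations of low degree that leave the curve invariant *)

Lemma mmap_polyC n (K : comNzRingType) (v : 'I_n -> K) (p : {mpoly K[n]}) :
  mmap polyC (fun j => (v j)%:P) p = (p.@[v])%:P.
Proof.
rewrite /meval /mmap rmorph_sum; apply: eq_bigr => m _ /=.
rewrite rmorphM rmorph_prod; congr (_ * _).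
by apply: eq_bigr => j _; rewrite rmorphXn.
Qed.

(** A point q off the curve, completed to a basis; an N-th root normalizes the
    value of f at q. *)
Lemma ex_frame (C : numClosedFieldType) N (f : {mpoly C[3]}) :
    (0 < N)%N -> f \is N.-homog -> f != 0 ->
  exists2 B : 'M[C]_3, B \in unitmx & f.@[B 0] = 1.
Proof.
move=> N0 hf f0.
have [q fq] : exists q, f.@[q] != 0.
  apply: contrapT => h; case/eqP: f0; apply: meval_eq0 => v.
  by apply/eqP; apply: contrapT => /negP fv; apply: h; exists v.
pose A := \row_j q j; pose E := row_ebase A.
have A0 : A != 0.
  apply: contraNneq fq => A0.
  have q0 : q = fun j => 0 * q j.
    by apply/funext => j; have /rowP/(_ j) := A0; rewrite !mxE mul0r.
  by rewrite q0 (meval_dhomogZ _ _ hf) expr0n eqn0Ngt N0 mul0r.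
(* The first row of the extended row basis of A spans the row space of A. *)
have qE : q = fun j => col_ebase A 0 0 * E 0 j.
  apply/funext => j; have := mulmx_ebase A; rewrite rank_rV A0 /=.
  move/rowP/(_ j); rewrite [RHS]mxE => <-; rewrite -mulmxA !mxE big_ord1; congr (_ * _).
  rewrite mxE (bigD1 0) //= big1 ?addr0; first by rewrite !mxE mul1r.
  by move=> [[|k] hk] //= _; rewrite !mxE mul0r.
have fE : f.@[E 0] != 0.
  by apply: contraNneq fq => fE; rewrite qE (meval_dhomogZ _ _ hf) fE mulr0.
pose t := N.-root f.@[E 0].
have t0 : t != 0 by rewrite rootC_eq0.
exists (t^-1 *: E); first by rewrite unitmxZ ?row_ebase_unit // unitfE invr_eq0.
rewrite (_ : (t^-1 *: E) 0 = fun j => t^-1 * E 0 j); last first.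
  by apply/funext => j; rewrite mxE.
by rewrite (meval_dhomogZ _ _ hf) exprVn rootCK // mulVf.
Qed.

(** In the coordinates of a frame B whose first vector q satisfies f q = 1, the
    restriction F of f is monic in y of degree m + 3. On the curve w = h grad f,
    and the hypothesis bounds |P| |h| at every point P. The coordinates of P in
    the frame other than the one along q are 1 and x, and they are linear forms
    in P, so both h and x h are bounded. Hence h = 0 on almost all fibres, where
    w has more zeros than its degree m + 1. *)
Lemma tangent_field_vanish (C : numClosedFieldType) m (f : {mpoly C[3]})
    (w : 'I_3 -> {mpoly C[3]}) (K : C) :
    f \is m.+3.-homog -> f != 0 -> nondegenerate f ->
    (forall i, w i \is m.+1.-homog) ->
    (forall v, f.@[v] = 0 ->
       forall i j, (w i).@[v] * (f^`M(j)).@[v] = (w j).@[v] * (f^`M(i)).@[v]) ->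
    0 <= K ->
    (forall i v l, `|v l| * `|(w i).@[v]| <= K * \sum_j `|(f^`M(j)).@[v]|) ->
  forall i, w i = 0.
Proof.
move=> hf f0 ndeg hw orth K0 bnd i; have [B uB fB] := ex_frame (ltn0Sn _) hf f0.
pose F := restrict B f.
have [szF coF] := size_coef_pencil polyC (fun j => (B 1 j)%:P + B (1 + 1) j *: 'X)
  (fun j => (B 0 j)%:P) hf.
rewrite mmap_polyC fB -/(restrict B f) -/F in szF coF.
have {}szF : size F = m.+4.
  apply/eqP; rewrite eqn_leq szF ltnNge; apply/negP => /(nth_default 0) Fm.
  by move/eqP: coF; rewrite Fm eq_sym oner_eq0.
have mF : F \is monic by apply/monicP; rewrite /lead_coef szF.
have F0 : F != 0 by rewrite -size_poly_eq0 szF.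
have sepF : separable_poly F by exact: separable_restrict hf ndeg F0.
pose W := \sum_j restrict B (B 0 j *: w j).
have F'E x y : (fiber x F^`()).[y] = \sum_j B 0 j * (f^`M(j)).@[point B x y].
  exact: (evalxy_derives x y f (derives_y B)).
have WE x y : (fiber x W).[y] = \sum_j B 0 j * (w j).@[point B x y].
  rewrite /W [fiber x _]rmorph_sum horner_sum; apply: eq_bigr => j _ /=.
  by rewrite horner_restrict mevalZ.
have fF x y : (fiber x F).[y] = f.@[point B x y] by exact: horner_restrict.
(* W / F' is the factor h of proportionality between w and grad f. *)
have cross x y i' : (fiber x F).[y] = 0 ->
    (fiber x W).[y] * (f^`M(i')).@[point B x y]
      = (w i').@[point B x y] * (fiber x F^`()).[y].
  rewrite fF WE F'E => /orth h; rewrite mulr_suml mulr_sumr; apply: eq_bigr => j _.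
  by rewrite -mulrA h mulrCA.
have key x y l : (fiber x F).[y] = 0 -> (fiber x F^`()).[y] != 0 ->
    `|point B x y l| * `|(fiber x W).[y]| <= 3%:R * K * `|(fiber x F^`()).[y]|.
  move=> Fxy F'xy; set P := point B x y; pose G := \sum_j `|(f^`M(j)).@[P]|.
  have G0 : 0 < G.
    rewrite lt_def sumr_ge0 // andbT; apply: contraNneq F'xy => G0.
    rewrite F'E big1 // => j _; have /eqP := G0; rewrite psumr_eq0 // => /allP/(_ j).
    by rewrite mem_index_enum normr_eq0 => /(_ isT)/eqP->; rewrite mulr0.
  rewrite -(ler_pM2r G0) -[leLHS]mulrA.
  have -> : `|(fiber x W).[y]| * G = \sum_j `|(w j).@[P]| * `|(fiber x F^`()).[y]|.
    by rewrite mulr_sumr; apply: eq_bigr => j _; rewrite -!normrM cross.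
  rewrite -mulr_suml mulrA [leRHS]mulrAC ler_wpM2r // mulr_sumr.
  rewrite (le_trans (ler_sum _ (fun j _ => bnd j P l))) //.
  by rewrite sumr_const card_ord -mulrA mulr_natl.
pose L := 3%:R * K * \sum_k \sum_l `|invmx B l k|.
have L0 : 0 <= L.
  by rewrite !mulr_ge0 // sumr_ge0 // => k _; rewrite sumr_ge0.
have dual x y k : (fiber x F).[y] = 0 -> (fiber x F^`()).[y] != 0 ->
    `|(\sum_l point B x y l * invmx B l k) * (fiber x W).[y]|
      <= L * `|(fiber x F^`()).[y]|.
  move=> Fxy F'xy; rewrite normrM mulrC.
  rewrite (le_trans (ler_wpM2l (normr_ge0 _) (ler_norm_sum _ _ _))) //.
  have lek : \sum_l `|invmx B l k| <= \sum_k \sum_l `|invmx B l k|.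
    by rewrite [leRHS](bigD1 k) //= lerDl sumr_ge0 // => k' _; rewrite sumr_ge0.
  rewrite /L [leRHS]mulrAC; apply: le_trans (ler_wpM2l _ lek); last first.
    by rewrite !mulr_ge0.
  rewrite !mulr_sumr; apply: ler_sum => l _.
  by rewrite normrM mulrA ler_wpM2r // mulrC key.
have coord x y k : \sum_l point B x y l * invmx B l k =
    (k == 1)%:R + x * (k == 1 + 1)%:R + y * (k == 0)%:R.
  have bd := frame_dual uB; rewrite -!(eq_sym _ k) -!bd !mulr_sumr -!big_split.
  by apply: eq_bigr => l _; rewrite /point /=; ring.
have [x y Fxy F'xy|D D0 hD] := vanish_off_discriminant (W := W) mF szF sepF L0.
  split; [have := dual x y 1 Fxy F'xy | have := dual x y (1 + 1) Fxy F'xy].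
    by rewrite coord /= !mulr0 !addr0 mul1r.
  by rewrite coord /= !mulr0 !addr0 add0r mulr1.
have w0 x y : (w i).@[point B x y] = 0.
  rewrite -horner_restrict; suff -> : restrict B (w i) = 0.
    by rewrite /fiber rmorph0 horner0.
  apply: (eq0_of_fiber_vanish mF szF D0).
    have [sw _] := size_coef_pencil polyC (fun j => (B 1 j)%:P + B (1 + 1) j *: 'X)
      (fun j => (B 0 j)%:P) (hw i).
    by rewrite (leq_trans sw).
  move=> x' y' Dx Fxy; have [F'xy Wxy] := hD x' y' Dx Fxy; split; first exact: F'xy.
  have /eqP := cross x' y' i Fxy.
  by rewrite Wxy mul0r eq_sym mulf_eq0 (negPf F'xy) orbF horner_restrict => /eqP.
(* l1 is the coordinate that [point] normalizes to 1: homogeneity gives the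
   vanishing of w i wherever l1 does not vanish. *)
pose l1 : {mpoly C[3]} := \sum_j invmx B j 1 *: 'X_j.
have l1E v : l1.@[v] = \sum_j v j * invmx B j 1.
  by rewrite raddf_sum; apply: eq_bigr => j _ /=; rewrite mevalZ mevalXU mulrC.
have l1_neq0 : l1 != 0.
  apply/eqP => l10; have /eqP := l1E (B 1); rewrite (frame_dual uB) l10 meval0 eqxx.
  by rewrite eq_sym oner_eq0.
have : l1 * w i = 0.
  apply: meval_eq0 => v; rewrite mevalM l1E.
  have [c vE] := frame_coord uB v.
  have -> : \sum_j v j * invmx B j 1 = c 1.
    under eq_bigr => j _ do rewrite vE mulr_suml.
    rewrite exchange_big (bigD1 1) //= [X in _ + X]big1 => [|k /negPf k1].
      under eq_bigr => j _ do rewrite -mulrA.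
      by rewrite -mulr_sumr frame_dual // eqxx mulr1 addr0.
    by under eq_bigr => j _ do rewrite -mulrA; rewrite -mulr_sumr frame_dual // k1 mulr0.
  have [->|c1] := eqVneq (c 1) 0; first by rewrite mul0r.
  have -> : v = fun j => c 1 * point B (c (1 + 1) / c 1) (c 0 / c 1) j.
    by apply/funext => j; rewrite vE (sum_ord3_at 0) add0r /point; field.
  by rewrite (meval_dhomogZ _ _ (hw i)) w0 !mulr0.
by move/eqP; rewrite mulf_eq0 (negPf l1_neq0) => /eqP.
Qed.

(** * Syzygies of the partial derivatives *)

Section Syzygy.
Variables (K : numFieldType) (m d : nat) (f : {mpoly K[3]}) (a : 'I_3 -> {mpoly K[3]}).
Hypotheses (hf : f \is m.+2.-homog) (ha : forall i, a i \is d.-homog).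
Hypothesis syz : \sum_i a i * f^`M(i) = 0.

(** Interior product of the volume form with the vector field a and the Euler
    field: the 1-form that defines the foliation of the plane induced by a. *)
Definition tangent_form i : {mpoly K[3]} := cross (fun j => 'X_j) a i.

Lemma dhomog_tangent_form i : tangent_form i \is d.+1.-homog.
Proof.
have hX j k : 'X_j * a k \is d.+1.-homog.
  by rewrite -[d.+1]add1n; apply: dhomogM (ha k); rewrite dhomogX /= mdeg1.
by rewrite rpredB ?hX.
Qed.

Lemma meval_tangent_form v i : (tangent_form i).@[v] = cross v (fun j => (a j).@[v]) i.
Proof. by rewrite mevalB !mevalM !mevalXU. Qed.

Lemma tangent_form_orthogonal v : f.@[v] = 0 -> forall i j,
  (tangent_form i).@[v] * (f^`M(j)).@[v] = (tangent_form j).@[v] * (f^`M(i)).@[v].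
Proof.
move=> fv i j; rewrite !meval_tangent_form.
apply: (@cross_orthogonal _ v _ (fun j => (f^`M(j)).@[v])).
  by rewrite (euler_meval v hf) fv mulr0.
have := congr1 (meval v) syz; rewrite meval0 raddf_sum /= => E; rewrite -[RHS]E.
by apply: eq_bigr => k _; rewrite mevalM.
Qed.

(** Differentiating the syzygy at a singular point v gives Hess f (v) a(v) = 0,
    and the kernel of the Hessian is spanned by v. *)
Lemma tangent_form_singular v : nondegenerate f -> (exists i, v i != 0) ->
  (forall i, (f^`M(i)).@[v] = 0) -> forall i, (tangent_form i).@[v] = 0.
Proof.
move=> ndeg v0 gv i.
have [l|s hs] := ndeg v v0 gv (fun j => (a j).@[v]).
  have := congr1 (fun p => (p^`M(l)).@[v]) syz.
  rewrite /= mderiv0 meval0 (raddf_sum (mderiv l)) raddf_sum => E.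
  rewrite -[RHS]E; apply: eq_bigr => j _ /=.
  by rewrite mderivM mevalD !mevalM gv mulr0 add0r mulrC mderiv_comm.
by rewrite meval_tangent_form /cross !hs; ring.
Qed.

Lemma syzygy_eq0 : f != 0 -> (forall i, tangent_form i = 0) -> forall i, a i = 0.
Proof.
move=> f0 w0 i; have /cross_eq0 par := w0.
have : a i * (f *+ m.+2) = 'X_i * \sum_j a j * f^`M(j).
  rewrite -(euler_dhomog hf) !mulr_sumr; apply: eq_bigr => j _.
  by rewrite mulrCA mulrA (par j i) mulrA.
move/eqP; rewrite syz mulr0 -scaler_nat -scalerAr scaler_eq0 pnatr_eq0.
by rewrite mulf_eq0 (negPf f0) orbF => /eqP.
Qed.

End Syzygy.

Lemma no_syzygy (R : realType) m (f : {mpoly R[i][3]}) (a : 'I_3 -> {mpoly R[i][3]}) :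
    f \is m.+3.-homog -> f != 0 -> nondegenerate f -> (forall i, a i \is m.-homog) ->
    \sum_i a i * f^`M(i) = 0 -> forall i, a i = 0.
Proof.
move=> hf f0 ndeg ha syz; have hw := dhomog_tangent_form ha.
have bnd i : exists2 K : R[i], 0 <= K & forall v l,
    `|v l| * `|(tangent_form a i).@[v]| <= K * \sum_j `|(f^`M(j)).@[v]|.
  apply: (global_bound (hw i)) => [l | v l vl gv]; first exact: dhomog_mderiv.
  have v0 : exists l, v l != 0 by exists l; rewrite vl oner_neq0.
  split; first exact: (tangent_form_singular syz).
  apply: injective_bound => u ul Hu.
  have [s hs] := ndeg v v0 gv u Hu.
  by have := hs l; rewrite ul vl mulr1 => s0 j; rewrite hs -s0 mul0r.
have [K K0 hK] := fin_all_exists2 bnd.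
apply: (syzygy_eq0 hf syz f0); apply: (tangent_field_vanish hf f0 ndeg hw _ (K := \sum_i K i)).
- by move=> v fv; apply: tangent_form_orthogonal syz _ fv; exact: hf.
- exact: sumr_ge0.
move=> i v l; apply: le_trans (hK i v l) _; apply: ler_wpM2r; first exact: sumr_ge0.
by rewrite (bigD1 i) //= lerDl sumr_ge0.
Qed.

Lemma no_syzygy_le (R : realType) N d (f : {mpoly R[i][3]}) (a : 'I_3 -> {mpoly R[i][3]}) :
    f \is N.-homog -> f != 0 -> nondegenerate f -> (d + 3 <= N)%N ->
    (forall i, a i \is d.-homog) -> \sum_i a i * f^`M(i) = 0 -> forall i, a i = 0.
Proof.
move=> hf f0 ndeg /subnK dN ha syz i.
(* Multiplication by a power of a coordinate raises the degree to N - 3. *)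
pose X : {mpoly R[i][3]} := 'X_0 ^+ (N - (d + 3)).
have hX : X \is (N - (d + 3)).-homog.
  by rewrite -[X in X.-homog]mul1n; apply: dhomogMn; rewrite dhomogX /= mdeg1.
have X0 : X != 0.
  by rewrite expf_neq0 // -msupp_eq0 msuppX.
move: hf; rewrite -dN addnA addn3 => hf.
have /eqP : X * a i = 0.
  apply: (no_syzygy (a := fun i => X * a i) hf f0 ndeg) => [j|].
    exact: dhomogM.
  by under eq_bigr => j _ do rewrite -mulrA; rewrite -mulr_sumr syz mulr0.
by rewrite mulf_eq0 (negPf X0) => /eqP.
Qed.

(** * Dimensions of the graded pieces of the Milnor algebra *)

Lemma pihomog_dhomogM n (K : comNzRingType) k e (p q : {mpoly K[n]}) : q \is e.-homog ->
  pihomog mdeg k (p * q) = if (e <= k)%N then pihomog mdeg (k - e) p * q else 0.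
Proof.
move=> hq; elim/mpolyind: p => [|c m p _ _ IHp].
  by rewrite mul0r !pihomog0 mul0r if_same.
have hmq : 'X_[m] * q \is (mdeg m + e).-homog by apply: dhomogM => //; rewrite dhomogX.
have Xq : pihomog mdeg k ('X_[m] * q) =
    if (e <= k)%N then pihomog mdeg (k - e) 'X_[m] * q else 0.
  rewrite pihomogX; have [<-|ne] := eqVneq (mdeg m + e)%N k.
    by rewrite leq_addl addnK eqxx pihomog_dE.
  rewrite (pihomog_ne0 ne hmq); case: leqP => // ek; case: eqP => [mk|]; last by rewrite mul0r.
  by rewrite mk subnK ?eqxx in ne.
rewrite mulrDl !pihomogD -scalerAl !linearZ /= IHp Xq; case: leqP => _.
  by rewrite mulrDl -scalerAl.
by rewrite scaler0 addr0.
Qed.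

Lemma jacobian_part_low (R : realType) n k (f : {mpoly R[i][3]}) :
  f \is n.+1.-homog -> (k < n)%N -> jacobian_part f k = 0%VS.
Proof.
move=> hf kn; apply/eqP; rewrite -subv0; apply/subvP => p /jacobian_partP[a pE].
rewrite memv0; apply/eqP/val_inj.
rewrite -[LHS](pihomog_dE (dhomog_is_dhomog p)) pE raddf_sum big1 // => i _ /=.
by rewrite (pihomog_dhomogM _ _ (dhomog_mderiv i hf)) leqNgt kn.
Qed.

Section JacobianMap.
Variables (R : realType) (n m : nat) (f : {mpoly R[i][3]}).
Hypothesis hf : f \is n.+1.-homog.
Local Notation V := {ffun 'I_3 -> dhomog 3 R[i] m}.

Lemma jacobian_comb_homog (a : V) : \sum_i val (a i) * f^`M(i) \is (m + n).-homog.
Proof.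
apply: rpred_sum => i _; apply: dhomogM; [exact: dhomog_is_dhomog | exact: dhomog_mderiv].
Qed.

Definition jacobian_comb (a : V) : dhomog 3 R[i] (m + n) := DHomog (jacobian_comb_homog a).

Lemma jacobian_comb_linear : linear jacobian_comb.
Proof.
move=> c a b; apply: val_inj => /=; rewrite scaler_sumr -big_split /=.
by apply: eq_bigr => i _; rewrite !ffunE /= mulrDl -scalerAl.
Qed.

HB.instance Definition _ := GRing.isLinear.Build R[i] V (dhomog 3 R[i] (m + n)) _
  jacobian_comb jacobian_comb_linear.

(** An element of J of degree m + n has coefficients that are forms of degree m:
    take homogeneous components of any expression of it. *)
Lemma jacobian_part_limg : jacobian_part f (m + n) = limg (linfun jacobian_comb).
Proof.
apply/vspaceP => p; apply/idP/idP => [/jacobian_partP[a pE] | /memv_imgP[a _ ->]].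
  apply/memv_imgP; exists [ffun i => DHomog (pihomogP mdeg m (a i))]; first exact: memvf.
  rewrite lfunE; apply: val_inj.
  rewrite -[LHS](pihomog_dE (dhomog_is_dhomog p)) pE raddf_sum.
  apply: eq_bigr => i _ /=; rewrite ffunE /=.
  by rewrite (pihomog_dhomogM _ _ (dhomog_mderiv i hf)) leq_addl addnK.
by apply/jacobian_partP; exists (fun i => val (a i)); rewrite lfunE.
Qed.

Lemma dim_jacobian_part : f != 0 -> nondegenerate f -> (m + 3 <= n.+1)%N ->
  \dim (jacobian_part f (m + n)) = \dim {: V}.
Proof.
move=> f0 ndeg mn; rewrite jacobian_part_limg limg_dim_eq //.
apply/eqP; rewrite -subv0; apply/subvP => a; rewrite memv_cap => /andP[_].
rewrite memv_ker lfunE => /eqP/(congr1 val) /= syz; rewrite memv0; apply/eqP/ffunP => i.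
apply: val_inj; rewrite ffunE /=.
apply: (no_syzygy_le (a := fun i => val (a i)) hf f0 ndeg mn _ syz i) => j.
exact: dhomog_is_dhomog.
Qed.

End JacobianMap.

Lemma milnor_dim_eq (R : realType) n k (f g : {mpoly R[i][3]}) :
    f \is n.+1.-homog -> f != 0 -> nondegenerate f ->
    g \is n.+1.-homog -> g != 0 -> nondegenerate g -> (k + 4 <= 2 * n.+1)%N ->
  milnor_dim f k = milnor_dim g k.
Proof.
move=> hf f0 nf hg g0 ng kn.
suff E : \dim (jacobian_part f k) = \dim (jacobian_part g k) by rewrite /milnor_dim E.
have [lt_kn | le_nk] := ltnP k n.
  by rewrite (jacobian_part_low hf lt_kn) (jacobian_part_low hg lt_kn).
have mn : (k - n + 3 <= n.+1)%N.
  by rewrite addnBAC // leq_subLR -ltnS -addnS (leq_trans kn) // mul2n -addnn addSn.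
by rewrite -(subnK le_nk) (dim_jacobian_part hf f0 nf mn) (dim_jacobian_part hg g0 ng mn).
Qed.

Lemma nodal_nondegenerate (R : realType) N (f : {mpoly R[i][3]}) :
  f \is N.-homog -> (forall v, singular_point f v -> node f v) -> (1 < N)%N -> nondegenerate f.
Proof. by case: N => [|[|d]] // hf nodes _; apply: node_nondegenerate hf nodes. Qed.

Theorem theorem1p2 (R : realType) (N : nat) (f fs : {mpoly R[i][3]})
    (hf : nodal_curve N f) (hfs : smooth_curve N fs) :
  ((2 * N%:R - 4 : R)%:E <= ct f fs)%E.
Proof.
have [[N0 hN f0] _ nodes] := hf; have [[_ hNs fs0] smooth] := hfs.
have [n defN] : exists n, N = n.+1 by exists N.-1; rewrite prednK.
apply: ereal_sup_ubound; exists (2 * N%:Z - 4); last by rewrite rmorphB rmorphM.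
move=> k kN; rewrite {}defN in hN hNs kN.
have kn : (k + 4 <= 2 * n.+1)%N by rewrite -lez_nat PoszD PoszM -lerBrDr.
have n1 : (1 < n.+1)%N by rewrite -(leq_pmul2l (ltn0Sn 1)) (leq_trans _ kn) // leq_addl.
apply: (milnor_dim_eq hN f0 _ hNs fs0 _ kn).
  exact: nodal_nondegenerate hN nodes n1.
by apply: nodal_nondegenerate hNs _ n1 => v /smooth.
Qed.
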